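(* Let $a\in\mathbb{R}$ and suppose that $\{\lambda_i,\varphi_i(a)\}_{i=1}^N$ is the interior spectral data at $a$ of some pair $(\omega,v)$. If $\alpha=\beta=0$ and $\varphi_i(a)\neq 0$ for all $i=1,\dots,N$, then $\{\lambda_i,\varphi_i(a)\}_{i=1}^N$ uniquely determines $\omega,v$; that is, $(\omega,v)$ is the only pair whose interior spectral data at $a$ is $\{\lambda_i,\varphi_i(a)\}_{i=1}^N$.
   Context: A pair $(\omega,v)$ means: for some $n\in\mathbb{N}$, $n\ge 1$, and real points $x_1<\dots<x_n$, $\omega=\sum_{i=1}^n\omega_i\delta_{x_i}$ and $v=\sum_{i=1}^n v_i\delta_{x_i}$ with $\omega_i\in\mathbb{R}$, $v_i\ge 0$ and $|\omega_i|+v_i>0$ ($\delta_x$ is the Dirac measure at $x$). The number $n$, the points and the weights may differ from pair to pair. For $z\in\mathbb{C}$ consider $-f''+\frac14 f=z\omega f+z^2vf$ on $\mathbb{R}$, meaning: $f$ is continuous, $-f''+\frac14 f=0$ on $\mathbb{R}\setminus\{x_1,\dots,x_n\}$, and $f'(x_i-)=f'(x_i+)+z\omega_if(x_i)+z^2v_if(x_i)$ for every $i$. An eigenvalue is a $z$ for which there is a nontrivial bounded solution. The eigenvalues form a finite set of nonzero real numbers $\lambda_1<\dots<\lambda_N$. For $z\in\mathbb{C}$, $\phi_\pm(z,\cdot)$ are the solutions with $\phi_\pm(z,x)=e^{\mp x/2}$ for all $x$ near $\pm\infty$. For an eigenvalue $\lambda$ put $\gamma_\lambda^2:=\int_{\mathbb{R}}|\phi_+(\lambda,x)|^2d\omega(x)+2\lambda\int_{\mathbb{R}}|\phi_+(\lambda,x)|^2dv(x)$;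 one has $\lambda\gamma_\lambda^2>0$. The normalized eigenfunctions are $\varphi_i(x)=\phi_+(\lambda_i,x)/\sqrt{\lambda_i\gamma_{\lambda_i}^2}$. For $a\in\mathbb{R}$, the family $\{\lambda_i,\varphi_i(a)\}_{i=1}^N$ is called the interior spectral data of $(\omega,v)$ at $a$. Put $\alpha:=1-\sum_{i=1}^N|\varphi_i(a)|^2$ and $\beta:=-\sum_{i=1}^N\lambda_i|\varphi_i(a)|^2$. *)

(* Defs.v *)
From HB Require Import structures.
From mathcomp Require Import all_boot all_order all_algebra.
From mathcomp Require Import complex.
From mathcomp Require Import all_classical all_reals all_analysis.
Set Implicit Arguments.
Unset Strict Implicit.
Unset Printing Implicit Defensive.
Import Order.TTheory GRing.Theory Num.Theory.
Import numFieldNormedType.Exports.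
Local Open Scope classical_set_scope.
Local Open Scope ring_scope.
Local Open Scope complex_scope.

Record coeff_pair (R : realType) := CoeffPair {
  natoms : nat;
  atom : 'I_natoms -> R;
  wweight : 'I_natoms -> R;
  vweight : 'I_natoms -> R;
  natoms_gt0 : (0 < natoms)%N;
  atom_lt : forall i j : 'I_natoms, (i < j)%N -> atom i < atom j;
  vweight_ge0 : forall i, 0 <= vweight i;
  weights_gt0 : forall i, 0 < `|wweight i| + vweight i }.

Section Measures.
Context {R : realType}.

Definition omega (p : coeff_pair R) (A : set R) : \bar R :=
  (\sum_(i < natoms p) (wweight i)%:E * \d_(atom i) A)%E.

Definition nu (p : coeff_pair R) (A : set R) : \bar R :=
  (\sum_(i < natoms p) (vweight i)%:E * \d_(atom i) A)%E.

(* The integrals of g against the finitely supported (signed) measures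
   omega p and nu p. *)
Definition int_omega (p : coeff_pair R) (g : R -> R) : R :=
  \sum_(i < natoms p) wweight i * g (atom i).

Definition int_nu (p : coeff_pair R) (g : R -> R) : R :=
  \sum_(i < natoms p) vweight i * g (atom i).

End Measures.

(* R[i] carries no normed R-module structure in the library, so calculus for
   complex-valued functions of a real variable is done componentwise. *)
Section ComplexValued.
Context {R : realType}.
Implicit Types (f : R -> R[i]) (x : R).

Definition ccvg (F : set_system R) f (l : R[i]) : Prop :=
  ((fun t => complex.Re (f t)) @ F --> complex.Re l) /\
  ((fun t => complex.Im (f t)) @ F --> complex.Im l).

Definition ccontinuous f : Prop := forall x, ccvg (nbhs x) f (f x).

Definition cderivable f x : Prop :=
  derivable (fun t => complex.Re (f t)) x 1 /\
  derivable (fun t => complex.Im (f t)) x 1.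

Definition cderive f : R -> R[i] :=
  fun x => (fun t => complex.Re (f t))^`()%classic x +i*
           (fun t => complex.Im (f t))^`()%classic x.

Definition cbounded f : Prop :=
  exists M : R, forall x, Normc.normc (f x) <= M.

End ComplexValued.

Section SpectralProblem.
Context {R : realType}.
Implicit Types (p : coeff_pair R) (z : R[i]) (f : R -> R[i]).

Definition solution p z f : Prop :=
  [/\ ccontinuous f,
      forall x, (forall i : 'I_(natoms p), x != atom i) ->
        [/\ cderivable f x, cderivable (cderive f) x &
            - cderive (cderive f) x + 4^-1 * f x = 0] &
      forall i : 'I_(natoms p), exists dl dr : R[i],
        [/\ ccvg (at_left (atom i)) (cderive f) dl,
            ccvg (at_right (atom i)) (cderive f) dr &
            dl = dr + z * (wweight i)%:C * f (atom i)
                    + z ^+ 2 * (vweight i)%:C * f (atom i)]].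

Definition is_eigenvalue p z : Prop :=
  exists f, [/\ solution p z f, cbounded f & exists x, f x != 0].

(* f is phi_+(z, .) *)
Definition phi_plus p z f : Prop :=
  solution p z f /\ \forall x \near +oo, f x = (expR (- x / 2))%:C.

(* gamma_lambda^2, with f = phi_+(lambda, .) *)
Definition gamma2 p (lambda : R) f : R :=
  int_omega p (fun x => Normc.normc (f x) ^+ 2) +
  2 * lambda * int_nu p (fun x => Normc.normc (f x) ^+ 2).

(* The values at a are a priori complex; that they are real is not built in. *)
Definition interior_spectral_data p (a : R) (N : nat)
    (lambda : 'I_N -> R) (phia : 'I_N -> R[i]) : Prop :=
  [/\ forall i j : 'I_N, (i < j)%N -> lambda i < lambda j,
      forall z, is_eigenvalue p z <-> exists i, z = (lambda i)%:C &
      forall i, exists f, phi_plus p (lambda i)%:C f /\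
        phia i = f a / (Num.sqrt (lambda i * gamma2 p (lambda i) f))%:C].

Definition alpha (N : nat) (phia : 'I_N -> R[i]) : R :=
  1 - \sum_(i < N) Normc.normc (phia i) ^+ 2.

Definition beta (N : nat) (lambda : 'I_N -> R) (phia : 'I_N -> R[i]) : R :=
  - \sum_(i < N) lambda i * Normc.normc (phia i) ^+ 2.

End SpectralProblem.

(* Main.v *)
Require Import Defs.
From mathcomp Require Import all_boot all_order all_algebra.
From mathcomp Require Import complex polyrcf ring lra zify.
From mathcomp Require Import all_classical all_reals all_analysis.
(**
Between two point masses a solution of the equation is [h e^(x/2) + g e^(-x/2)];
call [(h, g)] its state.  The state changes only at the masses, and there it is
multiplied by an explicit matrix of determinant one whose entries are affine in
[c = z omega_i + z^2 v_i] ([cross]).  So the coefficients of the solutions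
[phi_+] and [phi_-] are polynomials in [z], and so are [P = phi_+(z, a)],
[Q = phi_-(z, a)] and the Wronskian [W] of the two solutions.  The roots of [W]
are the eigenvalues ([eigenvalueP]).

What the spectral data say about these polynomials.  Differentiating the Wronskian
in [z] gives [W'(lambda) h = - gamma_lambda^2], where [h] is the constant with
[phi_+ = h phi_-] at the eigenvalue [lambda] ([deriv_state]).  As the values
[varphi_i(a)] do not vanish, [gamma_lambda^2] does not vanish, so [W] has simple
roots and is determined by them, because [W(0) = 1].  The same identity gives
[(P Q)(lambda_i) = - W'(lambda_i) lambda_i varphi_i(a)^2].  The degree of [P Q] is at
most that of [W] ([size_characteristic]), so these values and [(P Q)(0) = 1]
determine [P Q]; the hypotheses [alpha = 0] and [beta = 0] say that its degree is
lower by at least two than that of [W] ([product_interpolation]).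

How [P] and [Q] are told apart.  Suppose that two pairs have the same data, with
polynomials [P1, Q1] and [P2, Q2].  The data fix the sign of [phi_+] at [a] for each
eigenvalue, hence [z P1 Q2] has at each [lambda_i] the same sign as [z P1 Q1], namely
that of [- W'(lambda_i)].  These signs alternate, so [z P1 Q2] has a root in each of
the gaps between consecutive eigenvalues.  Each of these roots is a root of
[z P1 Q1 = z P2 Q2], which has degree at most the number of gaps.  So [z P1 Q1]
divides [z P1 Q2], and [Q1] divides [Q2] ([dvdp_of_interlacing]).  By symmetry
[Q1 = Q2], and then [P1 = P2].

How the weights are found.  The right derivative of [phi_+] at a point has at most
the degree in [z] of the value of [phi_+] there, and the left derivative of [phi_-]
behaves in the same way ([dominated]).  Since [P] and [Q] are coprime, this turns the
equality of the two Wronskians into equality of the states on both sides of [a] and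
of the weights at [a] ([slope_unique]).  The same degree argument, repeated from mass
to mass on each side of [a], gives all the other weights ([state_inj]).  No position
has to be found: both pairs are read on the union of their positions, with zero
weights allowed.
*)

Set Implicit Arguments.
Unset Strict Implicit.
Unset Printing Implicit Defensive.
Import Order.TTheory GRing.Theory Num.Theory.
Import numFieldNormedType.Exports.
Local Open Scope ring_scope.

(** * Crossing a point mass *)

Section Crossing.
Context {S : comNzRingType}.
Implicit Types (u t c : S) (st : S * S).

(** With [u = e^(x/2)] and [t = e^(-x/2)], the value at [x] of the solution whose
    state is [st]. *)
Definition value u t st : S := st.1 * u + st.2 * t.

(** From the state on the right of a mass at [x] to the state on its left, when
    [f'(x-) = f'(x+) + c f(x)].  The value at [x] is the same for both states, which
    makes the map invertible, with inverse obtained by changing the sign of [c]. *)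
Definition cross u t c st : S * S :=
  (st.1 + t * c * value u t st, st.2 - u * c * value u t st).

Definition flip st : S * S := (st.2, st.1).

Definition wronskian st1 st2 : S := st1.1 * st2.2 - st2.1 * st1.2.

Lemma value_cross u t c st : u * t = 1 ->
  value u t (cross u t c st) = value u t st.
Proof. by case: st => h g ut; rewrite /value /=; ring: ut. Qed.

Lemma crossK u t c : u * t = 1 -> cancel (cross u t c) (cross u t (- c)).
Proof.
move=> ut [h g]; rewrite {1}/cross value_cross// /cross /=.
by congr pair; ring.
Qed.

Lemma wronskian_cross u t c st1 st2 : u * t = 1 ->
  wronskian (cross u t c st1) (cross u t c st2) = wronskian st1 st2.
Proof.
case: st1 st2 => [h1 g1] [h2 g2] ut.
by rewrite /wronskian /cross /value /=; ring: ut.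
Qed.

Lemma cross_linear u t c k1 k2 st1 st2 :
  cross u t c (k1 * st1.1 + k2 * st2.1, k1 * st1.2 + k2 * st2.2) =
  (k1 * (cross u t c st1).1 + k2 * (cross u t c st2).1,
   k1 * (cross u t c st1).2 + k2 * (cross u t c st2).2).
Proof. by rewrite /cross /value /=; congr pair; ring. Qed.

(** The reflection [x -> - x] exchanges the two components of a state and the two
    sides of the mass. *)
Lemma cross_flip u t c st :
  flip (cross u t (- c) st) = cross t u c (flip st).
Proof. by rewrite /flip /cross /value /=; congr pair; ring. Qed.

End Crossing.

(** * Solutions as polynomials in the spectral parameter *)

Section States.
Context {R : realType}.
Implicit Types (w v : R -> R) (x y : R) (s l r : seq R).

(** The solution [e^(x/2)] of [f'' = f / 4]. *)
Definition ehalf x : R := expR (x / 2).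

Lemma ehalf_gt0 x : 0 < ehalf x. Proof. exact: expR_gt0. Qed.

Lemma ehalfN x : ehalf x * ehalf (- x) = 1.
Proof. by rewrite /ehalf -expRD mulNr subrr expR0. Qed.

Definition coupling w v x : {poly R} := (w x)%:P * 'X + (v x)%:P * 'X^2.

Definition pcross w v x : {poly R} * {poly R} -> {poly R} * {poly R} :=
  cross (ehalf x)%:P (ehalf (- x))%:P (coupling w v x).

Definition pvalue x : {poly R} * {poly R} -> {poly R} :=
  value (ehalf x)%:P (ehalf (- x))%:P.

(** The state of [phi_+] on the left of all positions of the increasing list [s]:
    near [+oo] this solution is [e^(-x/2)]. *)
Definition state w v s : {poly R} * {poly R} := foldr (pcross w v) (0, 1) s.

Definition mirror w : R -> R := fun x => w (- x).

(** The state of [phi_-] on the right of all positions of [l].  As [phi_-] is the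
    reflection of the [phi_+] of the reflected weights, the results on [state]
    apply to it. *)
Definition lstate w v l : {poly R} * {poly R} :=
  flip (state (mirror w) (mirror v) (rev (map -%R l))).

Lemma pehalfN x : (ehalf x)%:P * (ehalf (- x))%:P = 1 :> {poly R}.
Proof. by rewrite -polyCM ehalfN. Qed.

Definition uncross w v (st : {poly R} * {poly R}) x : {poly R} * {poly R} :=
  cross (ehalf x)%:P (ehalf (- x))%:P (- coupling w v x) st.

(** [phi_-] can also be followed from left to right, starting from [e^(x/2)]. *)
Lemma lstateE w v l : lstate w v l = foldl (uncross w v) (1, 0) l.
Proof.
rewrite /lstate /state.
rewrite -(foldl_rev (fun st x => pcross (mirror w) (mirror v) x st)) revK.
rewrite -[(0, 1)]/(flip (1 : {poly R}, 0 : {poly R})).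
elim: l (1, 0) => [|x l IH] st /=; first by case: st.
rewrite -IH; congr (flip (foldl _ _ _)).
rewrite /uncross cross_flip /pcross.
by congr (cross _ _ _ _); rewrite ?opprK// /coupling /mirror opprK.
Qed.

Lemma pvalue_pcross w v x st : pvalue x (pcross w v x st) = pvalue x st.
Proof. by rewrite /pvalue value_cross ?pehalfN. Qed.

Lemma uncross_linear w v l k1 k2 st1 st2 :
  foldl (uncross w v) (k1 * st1.1 + k2 * st2.1, k1 * st1.2 + k2 * st2.2) l =
  (k1 * (foldl (uncross w v) st1 l).1 + k2 * (foldl (uncross w v) st2 l).1,
   k1 * (foldl (uncross w v) st1 l).2 + k2 * (foldl (uncross w v) st2 l).2).
Proof.
elim: l st1 st2 => [//|x l IH] st1 st2 /=.
by rewrite -IH; congr (foldl _ _ _); apply: cross_linear.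
Qed.

Lemma uncrossK w v l st :
  foldl (uncross w v) (foldr (pcross w v) st l) l = st.
Proof.
by elim: l => [//|x l IH] /=; rewrite /uncross /pcross crossK ?pehalfN.
Qed.

Lemma pcrossK w v l st :
  foldr (pcross w v) (foldl (uncross w v) st l) l = st.
Proof.
elim: l st => [//|x l IH] st /=; rewrite IH /uncross /pcross.
by rewrite -{1}[coupling w v x]opprK crossK ?pehalfN.
Qed.

Lemma wronskian_foldr w v l st1 st2 :
  wronskian (foldr (pcross w v) st1 l) (foldr (pcross w v) st2 l) =
  wronskian st1 st2.
Proof. by elim: l => [//|x l IH] /=; rewrite wronskian_cross ?pehalfN. Qed.

(** The coefficient of [e^(-x/2)] in [phi_+] near [-oo], that is, the Wronskian of
    [phi_-] and [phi_+]. *)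
Definition characteristic w v s : {poly R} := (state w v s).2.

(** The Wronskian is preserved by every crossing, so it can be computed next to [a],
    where only the mass at [a] is left to cross. *)
Lemma characteristicE w v l a r :
  characteristic w v (l ++ a :: r) =
  wronskian (lstate w v l) (state w v r)
  - coupling w v a * pvalue a (state w v r) * pvalue a (lstate w v l).
Proof.
rewrite /characteristic /state foldr_cat /= -/(state w v r).
set st := pcross w v a _.
have -> : (foldr (pcross w v) st l).2 =
    wronskian (1, 0) (foldr (pcross w v) st l).
  by rewrite /wronskian /=; ring.
rewrite -[(1, 0)](pcrossK w v l) wronskian_foldr -lstateE.
rewrite /wronskian /st /pcross /cross /pvalue /value /=; ring.
Qed.

(** At a root of the Wronskian [phi_+] is a multiple of [phi_-], and the factor is
    read off near [-oo].  Followed back from [-oo] to [a], the part [e^(-x/2)] of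
    [phi_+] contributes the multiple of [characteristic]. *)
Lemma value_lstate_mod w v l a r : exists Y,
  pvalue a (state w v r) =
  (state w v (l ++ a :: r)).1 * pvalue a (lstate w v l)
  + characteristic w v (l ++ a :: r) * Y.
Proof.
exists (pvalue a (foldl (uncross w v) (0, 1) l)).
rewrite -(pvalue_pcross w v) lstateE.
rewrite /characteristic /state foldr_cat /= -/(state w v r).
set st := pcross w v a _; set T := foldr _ st l.
rewrite -[st in LHS](uncrossK w v l) -/T.
pose e1 : {poly R} * {poly R} := (1, 0); pose e2 : {poly R} * {poly R} := (0, 1).
have -> : T = (T.1 * e1.1 + T.2 * e2.1, T.1 * e1.2 + T.2 * e2.2).
  by case: T => h g /=; congr pair; ring.
rewrite -/e1 -/e2 uncross_linear /pvalue /value /=; ring.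
Qed.

Lemma coupling0 w v x : (coupling w v x).[0] = 0.
Proof. by rewrite /coupling !hornerE /= mulr0. Qed.

(** At [z = 0] there are no masses, so that [phi_+] is [e^(-x/2)] everywhere. *)
Lemma state0 w v s : (state w v s).1.[0] = 0 /\ (state w v s).2.[0] = 1.
Proof.
elim: s => [|x s [IH1 IH2]] /=; first by rewrite !hornerE.
rewrite !(hornerD, hornerN, hornerM, coupling0) IH1 IH2 !(mulr0, mul0r).
by rewrite hornerX !(mulr0, mul0r, addr0, subr0).
Qed.

Lemma pvalue_state0 w v s x : (pvalue x (state w v s)).[0] = ehalf (- x).
Proof.
have [h0 g0] := state0 w v s.
by rewrite /pvalue /value !(hornerD, hornerM) h0 g0 !hornerE.
Qed.

Lemma pvalue_lstate0 w v l x : (pvalue x (lstate w v l)).[0] = ehalf x.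
Proof.
have [h0 g0] := state0 (mirror w) (mirror v) (rev (map -%R l)).
by rewrite /pvalue /value !(hornerD, hornerM) h0 g0 !hornerE.
Qed.

(** [phi_+] at [x] only depends on the masses on the right of [x]. *)
Definition tail_value w v s x : {poly R} :=
  pvalue x (state w v [seq y <- s | x < y]).

(** Lagrange identity: crossing a mass at [x] changes the Wronskian of a solution
    with its derivative in [z] by [- c'(z) f(x)^2]. *)
Lemma deriv_state w v s : pairwise <%R s ->
  (state w v s).1 * (state w v s).2^`() - (state w v s).1^`() * (state w v s).2
  = - \sum_(x <- s) (coupling w v x)^`() * tail_value w v s x ^+ 2.
Proof.
elim: s => [_|x s IH /= /andP[xs ps]].
  by rewrite big_nil /= derivC; ring.
rewrite big_cons /= opprD.
have -> : \sum_(j <- s) (coupling w v j)^`() * tail_value w v (x :: s) j ^+ 2 =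
    \sum_(j <- s) (coupling w v j)^`() * tail_value w v s j ^+ 2.
  apply: eq_big_seq => y ys; congr (_ * _ ^+ 2).
  rewrite /tail_value /= ifN// -leNgt.
  by have /allP/(_ _ ys)/ltW := xs.
rewrite -IH// /tail_value /= ltxx.
have -> : [seq y <- s | x < y] = s by apply/all_filterP.
rewrite /pvalue /value /=; set h := (state w v s).1; set g := (state w v s).2.
have uu := pehalfN x.
rewrite !(derivD, derivN, derivM, derivC).
ring: uu.
Qed.

End States.

(** * Degrees in the spectral parameter *)

Lemma coefM_top (S : nzRingType) (p q : {poly S}) m n :
  (size p <= m.+1)%N -> (size q <= n.+1)%N ->
  (p * q)`_(m + n) = p`_m * q`_n.
Proof.
move=> sp sq; rewrite coefM.
have mn : (m < (m + n).+1)%N by lia.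
rewrite (bigD1 (Ordinal mn)) //= addKn big1 ?addr0// => i ne_im.
have [lt_im|lt_mi|e_im] := ltngtP i m; last by move: ne_im; rewrite -val_eqE /= e_im eqxx.
  by rewrite [q`__]nth_default ?mulr0//; apply: leq_trans sq _; lia.
by rewrite [p`__]nth_default ?mul0r//; apply: leq_trans sp _; lia.
Qed.

Section Dominance.
Context {R : realType}.
Implicit Types (w v : R -> R) (x y : R) (s l r : seq R).
Implicit Types (st : {poly R} * {poly R}).

(** With [n] the degree in [z] of the solution at [x], the inequality says that the
    coefficients of [z^n] in [f] and in [- f'] have the same strict sign.  As [x]
    decreases between two masses, the two exponentials only make it stronger, and
    crossing a mass raises the degree and yields equality at that mass. *)
Definition dominated x n st :=
  [/\ (size st.1 <= n.+1)%N, (size st.2 <= n.+1)%N &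
      (st.1`_n * ehalf x) ^+ 2 < (st.2`_n * ehalf (- x)) ^+ 2].

Lemma pvalueE x st : pvalue x st = ehalf x *: st.1 + ehalf (- x) *: st.2.
Proof. by rewrite /pvalue /value -!mul_polyC ![_ * _%:P]mulrC. Qed.

(** The top coefficients of the two exponential parts cannot cancel. *)
Lemma size_pvalue x n st : dominated x n st -> size (pvalue x st) = n.+1.
Proof.
move=> [s1 s2 lt12]; apply/eqP; rewrite eqn_leq; apply/andP; split.
  by apply/leq_sizeP => j nj; rewrite pvalueE coefD !coefZ !nth_default
    ?mulr0 ?addr0// (leq_trans _ nj).
rewrite ltnNge; apply/negP => /leq_sizeP/(_ _ (leqnn n)).
rewrite pvalueE coefD !coefZ => /eqP; rewrite addr_eq0 => /eqP e.
by move: lt12; rewrite [_ * ehalf x]mulrC e sqrrN mulrC ltxx.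
Qed.

Lemma dominatedW x y n st : x <= y -> dominated y n st -> dominated x n st.
Proof.
move=> xy [s1 s2 lt12]; split=> //.
apply: le_lt_trans (lt_le_trans lt12 _); rewrite !exprMn ler_wpM2l ?sqr_ge0//.
  by rewrite lerXn2r ?nnegrE ?expR_ge0// ler_expR; lra.
by rewrite lerXn2r ?nnegrE ?expR_ge0// ler_expR; lra.
Qed.

Lemma coupling_eq0 w v x : coupling w v x = 0 -> w x = 0 /\ v x = 0.
Proof.
move=> c0; split; have := congr1 (fun p : {poly R} => p`_1) c0.
  by rewrite coef0 coefD !coefCM coefX coefXn /= mulr1 mulr0 addr0.
have := congr1 (fun p : {poly R} => p`_2) c0.
by rewrite coef0 coefD !coefCM coefX coefXn /= mulr1 mulr0 add0r.
Qed.

Lemma size_coupling w v x : coupling w v x != 0 -> (1 < size (coupling w v x))%N.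
Proof.
move=> c0; rewrite ltnNge; apply/negP => /leq_sizeP c1.
have c01 := c1 _ (leqnn 1); case/eqP: c0; apply/polyP => i; rewrite coef0.
case: i => [|i]; last exact: c1.
by rewrite coefD !coefCM coefX coefXn /= !mulr0 addr0.
Qed.

Lemma dominated_pcross w v x y n st : x < y -> dominated y n st ->
  exists m, dominated x m (pcross w v y st).
Proof.
move=> xy dom; have [c0|c0] := eqVneq (coupling w v y) 0.
  exists n; rewrite /pcross c0 /cross !(mulr0, mul0r) addr0 subr0.
  by case: st dom => h g /(dominatedW (ltW xy)).
have sf := size_pvalue dom; have sc := size_coupling c0.
case: dom => s1 s2 _; set c := coupling w v y in c0 sc *.
set f := pvalue y st in sf *.
have f0 : f != 0 by rewrite -size_poly_gt0 sf.
pose m := (size (c * f)%R).-1.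
have scf : size (c * f)%R = (size c + n)%N by rewrite size_mul// sf addnS.
have e1 : (pcross w v y st).1 = st.1 + ehalf (- y) *: (c * f).
  by rewrite /pcross /cross -mul_polyC mulrA.
have e2 : (pcross w v y st).2 = st.2 - ehalf y *: (c * f).
  by rewrite /pcross /cross -mul_polyC mulrA.
have k0 : (c * f)`_m != 0 by rewrite -lead_coefE lead_coef_eq0 mulf_neq0.
have mE : m.+1 = size (c * f)%R by rewrite /m prednK// scf; lia.
exists m; split.
- rewrite e1 (leq_trans (size_polyD _ _))// geq_max (leq_trans s1) ?mE ?scf; last lia.
  by rewrite -scf; apply: size_scale_leq.
- rewrite e2 (leq_trans (size_polyD _ _))// geq_max (leq_trans s2) ?mE ?scf; last lia.
  by rewrite size_polyN -scf; apply: size_scale_leq.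
- rewrite e1 e2 coefD coefB !coefZ !(nth_default _ (leq_trans s1 _),
    nth_default _ (leq_trans s2 _)); try by rewrite -ltnS mE scf; lia.
  rewrite add0r sub0r; set k := (c * f)`_m in k0 *.
  have -> : ehalf (- y) * k * ehalf x = k * ehalf (x - y).
    by rewrite mulrAC -expRD [RHS]mulrC; congr (expR _ * _); field.
  have -> : - (ehalf y * k) * ehalf (- x) = - (k * ehalf (y - x)).
    by rewrite mulNr mulrAC -expRD [k * _]mulrC; congr (- (expR _ * _)); field.
  rewrite sqrrN !exprMn ltr_pM2l ?exprn_even_gt0//.
  by rewrite ltrXn2r ?expR_ge0// ?lerXn2r// ?ltr_expR //; lra.
Qed.

Lemma dominated_state w v x s : pairwise <%R s -> all (> x) s ->
  exists n, dominated x n (state w v s).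
Proof.
elim: s x => [|y s IH] x /=.
  move=> _ _; exists 0%N; split; rewrite /= ?size_poly0 ?size_poly1//.
  by rewrite coef0 mul0r coefC /= mul1r expr0n /= exprn_gt0// ehalf_gt0.
move=> /andP[ys ps] /andP[xy _]; have [n dom] := IH y ps ys.
exact: dominated_pcross xy dom.
Qed.

Lemma mirror_sorted x l : pairwise <%R l -> all (< x) l ->
  pairwise <%R (rev (map -%R l)) /\ all (> - x) (rev (map -%R l)).
Proof.
move=> pl lx; split; last first.
  by rewrite all_rev all_map; apply: sub_all lx => y /=; rewrite ltrN2.
rewrite -(sorted_pairwise lt_trans) rev_sorted sorted_map.
by move: pl; rewrite -(sorted_pairwise lt_trans); apply: sub_sorted => y z /=;
  rewrite ltrN2.
Qed.

Lemma flip_lstate w v l :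
  flip (lstate w v l) = state (mirror w) (mirror v) (rev (map -%R l)).
Proof. by rewrite /lstate; case: state. Qed.

Lemma dominated_mirror w v x l : pairwise <%R l -> all (< x) l ->
  exists n, dominated (- x) n (flip (lstate w v l)).
Proof.
move=> pl lx; have [pl' lx'] := mirror_sorted pl lx.
by rewrite flip_lstate; apply: dominated_state.
Qed.

Lemma couplingB w1 v1 w2 v2 x :
  coupling w1 v1 x - coupling w2 v2 x = coupling (w1 \- w2) (v1 \- v2) x.
Proof. by rewrite /coupling /= !polyCB; ring. Qed.

Lemma coupling_inj w1 v1 w2 v2 x : coupling w1 v1 x = coupling w2 v2 x ->
  w1 x = w2 x /\ v1 x = v2 x.
Proof.
move=> e; have : coupling (w1 \- w2) (v1 \- v2) x = 0.
  by rewrite -couplingB e subrr.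
by case/coupling_eq0 => /= /subr0_eq -> /subr0_eq ->.
Qed.

(** Two couplings that differ do so by a polynomial of degree one or two, too much
    for the degree allowed on the right-hand side. *)
Lemma coupling_small w1 v1 w2 v2 x (k f : {poly R}) :
  f != 0 -> (size k <= size f)%N ->
  (coupling w1 v1 x - coupling w2 v2 x) * f = k ->
  coupling w1 v1 x = coupling w2 v2 x.
Proof.
move=> f0 sk e; apply/eqP; rewrite -subr_eq0; apply/negPn/negP.
rewrite couplingB => c0; have := size_coupling c0; move: e; rewrite couplingB.
move: sk => /[swap] <-; rewrite size_mul//.
move: f0; rewrite -size_poly_gt0.
by move: (size _) (size _) => m n; lia.
Qed.

(** The leftmost mass comes off first: the value there is known, and the states
    beyond it have no higher degree than that value, so by [coupling_small] the
    weights agree; undoing the crossing leaves the shorter list. *)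
Lemma state_inj w1 v1 w2 v2 s : pairwise <%R s ->
  state w1 v1 s = state w2 v2 s ->
  forall x, x \in s -> w1 x = w2 x /\ v1 x = v2 x.
Proof.
elim: s => [//|y s IH] /= /andP[ys ps] e.
have [n1 d1] := dominated_state w1 v1 ps ys.
have [n2 d2] := dominated_state w2 v2 ps ys.
have ef : pvalue y (state w1 v1 s) = pvalue y (state w2 v2 s).
  by rewrite -(pvalue_pcross w1 v1) e pvalue_pcross.
have n12 : n1 = n2 by have := size_pvalue d1; rewrite ef (size_pvalue d2) => -[].
rewrite {}n12 in d1; move: (size_pvalue d2) => sf.
have f0 : pvalue y (state w2 v2 s) != 0 by rewrite -size_poly_gt0 sf.
have [e1 e2] : (pcross w1 v1 y (state w1 v1 s)).1 =
    (pcross w2 v2 y (state w2 v2 s)).1 /\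
  (pcross w1 v1 y (state w1 v1 s)).2 = (pcross w2 v2 y (state w2 v2 s)).2.
  by rewrite e.
have ec : coupling w1 v1 y = coupling w2 v2 y.
  apply: (@coupling_small _ _ _ _ _
    ((ehalf y)%:P * ((state w2 v2 s).1 - (state w1 v1 s).1)) _ f0).
    rewrite mul_polyC sf (leq_trans (size_scale_leq _ _))//.
    rewrite (leq_trans (size_polyD _ _))// size_polyN geq_max.
    by case: d1 d2 => -> _ _ [-> _ _].
  move: e1; rewrite /pcross /cross /= -/(pvalue y _) -/(pvalue y _) ef.
  move=> /eqP; rewrite -subr_eq0 => /eqP e1.
  have uu := pehalfN y; apply: subr0_eq; rewrite -[RHS](mulr0 (ehalf y)%:P) -e1.
  by ring: uu.
have es : state w1 v1 s = state w2 v2 s.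
  move: e1 e2; rewrite /pcross /cross /= -!/(pvalue y _) ef ec.
  move=> /addIr e1 /addIr e2; move: e1 e2.
  by case: (state w1 v1 s) (state w2 v2 s) => [? ?] [? ?] /= -> ->.
move=> x; rewrite inE => /predU1P[->|xs]; last exact: IH.
exact: coupling_inj.
Qed.

(** If there is a mass at [a], the last term of [characteristicE] has the highest
    degree.  Otherwise the degree of the product appears in the Wronskian with a
    nonzero coefficient, because the bounds of [dominated] on both sides of [a] point
    in opposite directions. *)
Lemma size_characteristic w v l a r :
  pairwise <%R l -> all (< a) l -> pairwise <%R r -> all (> a) r ->
  (size (pvalue a (state w v r) * pvalue a (lstate w v l))%R <=
   size (characteristic w v (l ++ a :: r)))%N.
Proof.
move=> pl la pr ra; rewrite characteristicE.
have [n [g1 g2 lt1]] := dominated_state w v pr ra.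
have [m [h1 h2 lt2]] := dominated_mirror w v pl la.
have sP : size (pvalue a (state w v r)) = n.+1 by apply: size_pvalue.
have sQ : size (pvalue a (lstate w v l)) = m.+1.
  have /size_pvalue <- : dominated (- a) m (flip (lstate w v l)) by split.
  by congr size; rewrite !pvalueE opprK addrC.
rewrite opprK in lt2.
move: g1 g2 lt1 h1 h2 lt2 sP sQ; set st := state w v r; set su := lstate w v l.
set P := pvalue a st; set Q := pvalue a su => g1 g2 lt1.
move=> h1 h2 lt2 sP sQ.
have {}h1 : (size su.2 <= m.+1)%N by [].
have {}h2 : (size su.1 <= m.+1)%N by [].
have {}lt2 : (su.2`_m * ehalf (- a)) ^+ 2 < (su.1`_m * ehalf a) ^+ 2 by [].
have P0 : P != 0 by rewrite -size_poly_gt0 sP.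
have Q0 : Q != 0 by rewrite -size_poly_gt0 sQ.
have sPQ : size (P * Q)%R = (m + n).+1 by rewrite size_mul// sP sQ; lia.
have sW : (size (wronskian su st) <= (m + n).+1)%N.
  have bnd i j : (i <= m.+1 -> j <= n.+1 -> (i + j).-1 <= (m + n).+1)%N by lia.
  rewrite /wronskian (leq_trans (size_polyD _ _))// size_polyN geq_max.
  rewrite !(leq_trans (size_polyMleq _ _))//.
    by rewrite addnC; apply: bnd.
  exact: bnd.
have [c0|c0] := eqVneq (coupling w v a) 0; last first.
  rewrite -mulrA.
  have := size_coupling c0 => sc.
  have PQ0 : P * Q != 0 by rewrite mulf_neq0.
  have scPQ : size (coupling w v a * (P * Q))%R = (size (coupling w v a) + (m + n))%N.
    by rewrite size_mul// sPQ addnS.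
  rewrite addrC size_polyDl size_polyN ?scPQ ?sPQ; first by lia.
  by apply: leq_ltn_trans sW _; lia.
rewrite c0 !mul0r subr0 sPQ ltnNge; apply/negP => /leq_sizeP/(_ _ (leqnn _)).
rewrite /wronskian coefB coefM_top// [(m + n)%N]addnC coefM_top//.
move: lt1 lt2 => {sP sQ}.
move: (st.1`_n) (st.2`_n) (su.1`_m) (su.2`_m) (ehalf a) (ehalf (- a)) (ehalfN a)
  => hp gp hm gm u t ut lt1 lt2 /subr0_eq e.
have : (hp * u) ^+ 2 * (gm * t) ^+ 2 < (gp * t) ^+ 2 * (hm * u) ^+ 2.
  by apply: ltr_pM; rewrite ?sqr_ge0.
have -> : (hp * u) ^+ 2 * (gm * t) ^+ 2 = (hp * gm * (u * t)) ^+ 2 by ring.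
have -> : (gp * t) ^+ 2 * (hm * u) ^+ 2 = (hm * gp * (u * t)) ^+ 2 by ring.
by rewrite e ltxx.
Qed.

End Dominance.

(** * Interlacing roots *)

Section Interlacing.
Context {R : realType} (n : nat) (lambda : 'I_n.+1 -> R).
Hypothesis lambda_lt : forall i j : 'I_n.+1, (i < j)%N -> lambda i < lambda j.
Implicit Types (W P Q : {poly R}).

Definition rootpoly : {poly R} := \prod_(i < n.+1) ('X - (lambda i)%:P).
Definition rootpoly_but i : {poly R} := \prod_(j < n.+1 | j != i) ('X - (lambda j)%:P).

Lemma lambda_inj : injective lambda.
Proof.
move=> i j; have [/lambda_lt|/lambda_lt|/val_inj//] := ltngtP i j.
  by move=> + e; rewrite e ltxx.
by move=> + e; rewrite e ltxx.
Qed.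

Lemma rootpolyE i : rootpoly = ('X - (lambda i)%:P) * rootpoly_but i.
Proof. by rewrite /rootpoly (bigD1 i). Qed.

Lemma size_rootpoly : size rootpoly = n.+2.
Proof.
by rewrite /rootpoly size_prod_XsubC -sum1_size sum1_card card_ord.
Qed.

Lemma rootpoly_but_monic i : rootpoly_but i \is monic.
Proof. by apply: monic_prod => j _; apply: monicXsubC. Qed.

Lemma size_rootpoly_but i : size (rootpoly_but i) = n.+1.
Proof.
have := size_rootpoly; rewrite (rootpolyE i) size_monicM ?monicXsubC//.
  by rewrite size_XsubC => -[].
by rewrite monic_neq0// rootpoly_but_monic.
Qed.

Lemma rootpoly_root i : rootpoly.[lambda i] = 0.
Proof. by rewrite (rootpolyE i) hornerM hornerXsubC subrr mul0r. Qed.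

Lemma deriv_rootpoly i : rootpoly^`().[lambda i] = (rootpoly_but i).[lambda i].
Proof.
rewrite (rootpolyE i) derivM derivXsubC mul1r !hornerE.
by rewrite subrr mul0r addr0.
Qed.

Lemma rootpoly_but_root i j : j != i -> (rootpoly_but i).[lambda j] = 0.
Proof.
by move=> ji; rewrite /rootpoly_but (bigD1 j)//= !hornerE subrr mul0r.
Qed.

Definition gap_lo (k : 'I_n) : 'I_n.+1 := widen_ord (leqnSn n) k.
Definition gap_hi (k : 'I_n) : 'I_n.+1 := lift ord0 k.

Lemma gap_lt k : lambda (gap_lo k) < lambda (gap_hi k).
Proof. by apply: lambda_lt; rewrite /= /bump /=. Qed.

(** The roots outside the gap contribute factors of equal sign at both ends. *)
Lemma rootpoly_alternates k :
  rootpoly^`().[lambda (gap_lo k)] * rootpoly^`().[lambda (gap_hi k)] < 0.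
Proof.
rewrite !deriv_rootpoly /rootpoly_but.
have lohi : gap_lo k != gap_hi k.
  by apply/eqP => /(congr1 lambda) e; have := gap_lt k; rewrite e ltxx.
rewrite (bigD1 (gap_hi k)) 1?eq_sym//= [X in _ * (X).[_]](bigD1 (gap_lo k))//=.
rewrite !hornerM !horner_prod !hornerXsubC.
set A := \prod_(_ | _) _; set B := \prod_(_ | _) _.
have AB : 0 < A * B.
  have -> : B = \prod_(i | (i != gap_lo k) && (i != gap_hi k))
      ('X - (lambda i)%:P).[lambda (gap_hi k)].
    by apply: eq_bigl => i; rewrite andbC.
  rewrite -big_split /=; apply: prodr_gt0 => i /andP[ilo ihi].
  rewrite !hornerXsubC.
  have [/lambda_lt lti|lei] := ltnP i (gap_lo k).
    by apply: mulr_gt0; rewrite subr_gt0// (lt_trans lti)// gap_lt.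
  have lti : (gap_hi k < i)%N.
    rewrite -val_eqE /= in ilo; rewrite -val_eqE /= /bump /= in ihi.
    rewrite /= /bump /=; rewrite /= in lei; lia.
  have := lambda_lt lti => /[dup] /(lt_trans (gap_lt k)) lt1 lt2.
  by rewrite nmulr_rgt0 subr_lt0.
have d := gap_lt k.
set x := lambda _ in d *; set y := lambda _ in d *.
have -> : (x - y) * A * ((y - x) * B) = - ((x - y) ^+ 2 * (A * B)) by ring.
by rewrite oppr_lt0 mulr_gt0// exprn_even_gt0//= subr_eq0 lt_eqF.
Qed.

(** A further root would be one of the [lambda i], hence a double root. *)
Lemma split_rootpoly W :
  (forall z : R[i], root (map_poly (real_complex R) W) z ->
     exists i, z = (lambda i)%:C%C) ->
  (forall i, W.[lambda i] = 0) -> (forall i, W^`().[lambda i] != 0) ->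
  W != 0 -> exists c : R, W = c *: rootpoly.
Proof.
move=> Wroot Wl Wd W0.
have /dvdpP[V WE] : rootpoly %| W.
  rewrite /rootpoly -(big_map lambda predT (fun z => 'X - z%:P)).
  apply: uniq_roots_dvdp.
    by apply/allP => z /mapP[i _ ->]; apply/rootP.
  by rewrite uniq_rootsE map_inj_uniq ?index_enum_uniq//; apply: lambda_inj.
have V0 : V != 0 by apply: contraNneq W0 => e; rewrite WE e mul0r.
have [/size1_polyC Vc|sV] := leqP (size V) 1.
  by exists V`_0; rewrite WE {1}Vc mul_polyC.
have sV' : size (map_poly (real_complex R) V) != 1%N.
  by rewrite size_map_poly; case: (size V) sV => [|[]].
have /closed_rootP[z zV] := sV'.
have [i zi] : exists i, z = (lambda i)%:C%C.
  by apply: Wroot; rewrite WE rmorphM /= rootM zV.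
have Vl : V.[lambda i] = 0.
  by move: zV; rewrite zi rootE horner_map /= => /eqP [].
have := Wd i; rewrite WE derivM hornerD !hornerM Vl mul0r addr0.
by rewrite rootpoly_root mulr0 eqxx.
Qed.

(** The formula holds at the [n + 1] points [lambda i] and, by the hypothesis on the
    squares, at [0].  The sum of the [lambda i * phi i ^+ 2] is, up to a factor, the
    coefficient of ['X^n]. *)
Lemma product_interpolation (c : R) (phi : 'I_n.+1 -> R) (D : {poly R}) :
  let W := c *: rootpoly in
  W.[0] = 1 ->
  \sum_i phi i ^+ 2 = 1 -> \sum_i lambda i * phi i ^+ 2 = 0 ->
  (size D <= n.+2)%N -> D.[0] = 1 ->
  (forall i, D.[lambda i] = - W^`().[lambda i] * lambda i * phi i ^+ 2) ->
  D = - c *: \sum_i (lambda i * phi i ^+ 2) *: rootpoly_but i /\ (size D <= n)%N.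
Proof.
move=> W W0 s1 s2 sD D0 Dl; set S := \sum_i _.
have lam0 i : lambda i != 0.
  apply: contra_eq_neq W0 => li.
  by rewrite hornerZ -{1}li rootpoly_root mulr0 eq_sym oner_neq0.
have bsum i : c * (rootpoly_but i).[0] = - (lambda i)^-1.
  have := W0; rewrite hornerZ (rootpolyE i) hornerM hornerXsubC => e.
  apply: (mulfI (lam0 i)); rewrite mulrN mulfV//.
  by rewrite -[in RHS]e; ring.
have sS : (size (- c *: S) <= n.+1)%N.
  rewrite (leq_trans (size_scale_leq _ _))// (leq_trans (size_sum _ _ _))//.
  apply/bigmax_leqP => i _.
  by rewrite (leq_trans (size_scale_leq _ _))// size_rootpoly_but.
have DE : D = - c *: S.
  apply/eqP; rewrite -subr_eq0; apply/eqP.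
  apply: (@roots_geq_poly_eq0 _ _ (0 :: [seq lambda i | i <- enum 'I_n.+1])).
  - apply/andP; split.
      rewrite rootE hornerD hornerN D0 hornerZ horner_sum.
      rewrite big_distrr /= (eq_bigr (fun i => phi i ^+ 2)) ?s1 ?subrr// => i _.
      rewrite hornerZ mulrCA mulNr bsum opprK.
      by rewrite mulrAC mulfV// mul1r.
    apply/allP => z /mapP[i _ ->]; rewrite rootE hornerD hornerN Dl.
    rewrite hornerZ horner_sum (bigD1 i)//= big1 => [|j ji]; last first.
      by rewrite hornerZ rootpoly_but_root ?mulr0 // eq_sym.
    rewrite derivZ !hornerZ deriv_rootpoly; apply/eqP; ring.
  - rewrite /= map_inj_uniq ?enum_uniq ?andbT; last exact: lambda_inj.
    by apply/mapP => -[i _] /esym/eqP; rewrite (negbTE (lam0 i)).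
  - rewrite /= size_map size_enum_ord (leq_trans (size_polyD _ _))//.
    by rewrite size_polyN geq_max sD (leq_trans sS).
split=> //; rewrite DE; apply/leq_sizeP => j nj.
have [e|ltnj] := eqVneq j n; last first.
  by rewrite nth_default// (leq_trans sS)// ltn_neqAle eq_sym ltnj.
rewrite coefZ coef_sum (eq_bigr (fun i => lambda i * phi i ^+ 2)) ?s2 ?mulr0//.
move=> i _; rewrite coefZ e.
have /monicP := rootpoly_but_monic i.
by rewrite lead_coefE size_rootpoly_but /= => ->; rewrite mulr1.
Qed.

(** ['X * P1 * Q2] has a root in each of the [n] gaps.  A root of [P1] or of [Q2] is a
    root of [P1 * Q1 = P2 * Q2], and ['X * P1 * Q1] has no room for other roots. *)
Lemma dvdp_of_interlacing P1 Q1 P2 Q2 :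
  P1 * Q1 = P2 * Q2 -> P1 * Q1 != 0 -> (size (P1 * Q1)%R <= n)%N ->
  (forall k, (lambda (gap_lo k) * (P1.[lambda (gap_lo k)] * Q2.[lambda (gap_lo k)]))
     * (lambda (gap_hi k) * (P1.[lambda (gap_hi k)] * Q2.[lambda (gap_hi k)])) < 0) ->
  Q1 %| Q2.
Proof.
move=> e D0 sD sgn; pose p := 'X * (P1 * Q2).
have /boolp.choice[mu hmu] k : exists x,
    [/\ lambda (gap_lo k) < x, x < lambda (gap_hi k) & root p x].
  have [||x] := @poly_ivtoo _ p (lambda (gap_lo k)) (lambda (gap_hi k)).
  - exact/ltW/gap_lt.
  - by rewrite /p !hornerM !hornerX.
  - by rewrite in_itv /= => /andP[? ?] ?; exists x.
have mu_lt (i j : 'I_n) : (i < j)%N -> mu i < mu j.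
  move=> ij; have [_ h1 _] := hmu i; have [h2 _ _] := hmu j.
  apply: lt_trans h1 (le_lt_trans _ h2).
  have [->//|ne] := eqVneq (gap_hi i) (gap_lo j).
  apply/ltW/lambda_lt; move: ne; rewrite -val_eqE /= /bump /=.
  by move: ij; lia.
have mu_inj : injective mu.
  move=> i j; have [/mu_lt|/mu_lt|/val_inj//] := ltngtP i j.
    by move=> + E; rewrite E ltxx.
  by move=> + E; rewrite E ltxx.
pose M := \prod_(z <- [seq mu k | k <- enum 'I_n]) ('X - z%:P).
have Mdvd q : (forall k, root q (mu k)) -> M %| q.
  move=> qmu; apply: uniq_roots_dvdp.
    by apply/allP => z /mapP[i _ ->].
  by rewrite uniq_rootsE map_inj_uniq ?enum_uniq.
have Mp : M %| p by apply: Mdvd => k; have [] := hmu k.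
have MD : M %| 'X * (P1 * Q1).
  apply: Mdvd => k; have [_ _] := hmu k.
  rewrite /p !rootM => /or3P[->//|->|Q2k]; first by rewrite orbT.
  by rewrite -rootM e rootM Q2k !orbT.
have XD0 : 'X * (P1 * Q1) != 0 by rewrite mulf_neq0 ?polyX_eq0.
have sM : size M = n.+1 by rewrite size_prod_XsubC size_map size_enum_ord.
have MXD : M %= 'X * (P1 * Q1).
  rewrite -dvdp_size_eqp// eqn_leq dvdp_leq// sM mulrC size_mulX//.
have : 'X * (P1 * Q1) %| 'X * (P1 * Q2) by rewrite -(eqp_dvdl _ MXD).
rewrite !mulrA dvdp_mul2l// mulf_neq0 ?polyX_eq0//.
by apply: contraNneq D0 => ->; rewrite mul0r.
Qed.

Lemma coprime_rootpoly P (c : R) : (forall i, P.[lambda i] != 0) -> c != 0 ->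
  coprimep P (c *: rootpoly).
Proof.
move=> Pl c0; rewrite coprimepZr//.
rewrite /rootpoly; apply: (big_ind (coprimep P)).
- exact: coprimep1.
- by move=> p q cp cq; rewrite coprimepMr cp.
- by move=> i _; rewrite coprimep_XsubC rootE.
Qed.

End Interlacing.

(** * Uniqueness of the weights *)

Section Uniqueness.
Context {R : realType}.
Implicit Types (w v : R -> R) (a : R) (l r s : seq R).

(** [gamma_z^2], as a polynomial in [z]. *)
Definition norming w v s (z : R) : R :=
  (\sum_(x <- s) (coupling w v x)^`() * tail_value w v s x ^+ 2).[z].

(** Interior spectral data at [a], in terms of the polynomials above; the masses are
    among the positions [l ++ a :: r]. *)
Definition weight_data w v l a r N (lambda phi : 'I_N -> R) :=
  let s := l ++ a :: r in
  [/\ forall z : R[i],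
        root (map_poly (real_complex R) (characteristic w v s)) z ->
        exists i, z = (lambda i)%:C%C,
      forall i, (characteristic w v s).[lambda i] = 0,
      forall i, 0 < lambda i * norming w v s (lambda i) &
      forall i, phi i = (pvalue a (state w v r)).[lambda i] /
                        Num.sqrt (lambda i * norming w v s (lambda i))].

Lemma dvdp_small (p q : {poly R}) : p %| q -> (size q <= size p)%N ->
  p.[0] != 0 -> q.[0] = 0 -> q = 0.
Proof.
move=> /dvdpP[t ->] sq p0; rewrite hornerM => /eqP.
rewrite mulf_eq0 (negbTE p0) orbF => /eqP t0.
have pn0 : p != 0 by apply: contraNneq p0 => ->; rewrite horner0.
have [->|tn0] := eqVneq t 0; first by rewrite mul0r.
have st : (size t <= 1)%N.
  move: sq pn0 tn0; rewrite -!size_poly_gt0 => + pn0 tn0.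
  rewrite size_mul -?size_poly_gt0//.
  by move: pn0 tn0; move: (size _) (size _) => i j; lia.
by move: t0 tn0; rewrite (size1_polyC st) hornerC => ->; rewrite eqxx.
Qed.

Lemma char_value w v s z : pairwise <%R s -> (characteristic w v s).[z] = 0 ->
  (characteristic w v s)^`().[z] * (state w v s).1.[z] = - norming w v s z.
Proof.
move=> ps W0; rewrite /norming -hornerN -deriv_state// hornerD hornerN !hornerM.
by rewrite -/(characteristic w v s) W0 mulr0 subr0 mulrC.
Qed.

Lemma value_at_eigenvalue w v l a r N (lambda phi : 'I_N -> R) i :
  weight_data w v l a r lambda phi ->
  exists2 m, 0 < m & (pvalue a (state w v r)).[lambda i] = phi i * m.
Proof.
move=> [_ _ G0 phiE]; exists (Num.sqrt (lambda i * norming w v (l ++ a :: r) (lambda i))).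
  by rewrite sqrtr_gt0.
by rewrite phiE divfK// gt_eqF// sqrtr_gt0.
Qed.

(** With [h] the ratio of [phi_+] to [phi_-], [P Q] is [P^2 / h], while [deriv_state]
    gives [W' = - gamma^2 / h]; eliminate [h]. *)
Lemma product_at_eigenvalue w v l a r N (lambda phi : 'I_N -> R) :
  pairwise <%R (l ++ a :: r) -> weight_data w v l a r lambda phi ->
  let W := characteristic w v (l ++ a :: r) in
  forall i, W^`().[lambda i] != 0 /\
    (pvalue a (state w v r) * pvalue a (lstate w v l)).[lambda i] =
    - W^`().[lambda i] * lambda i * phi i ^+ 2.
Proof.
move=> pU [_ W0 G0 phiE] W i.
have := char_value pU (W0 i); rewrite -/W.
move: (G0 i) (phiE i); set G := norming _ _ _ _ => lG pE WH.
have Gn0 : G != 0 by apply: contraTneq lG => ->; rewrite mulr0 ltxx.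
have [Y PQ0] := value_lstate_mod w v l a r.
have PQ : (pvalue a (state w v r)).[lambda i] =
    (state w v (l ++ a :: r)).1.[lambda i] * (pvalue a (lstate w v l)).[lambda i].
  by rewrite PQ0 hornerD !hornerM W0 mul0r addr0.
rewrite hornerM.
split; first by apply: contraNneq Gn0 => Wd; rewrite -oppr_eq0 -WH Wd mul0r.
set P := (pvalue a (state w v r)).[_] in PQ pE *.
set Q := (pvalue a (lstate w v l)).[_] in PQ *.
set H := (state _ _ _).1.[_] in PQ WH.
have P2 : P ^+ 2 = phi i ^+ 2 * (lambda i * G).
  rewrite pE expr_div_n sqr_sqrtr ?ltW// divfK//.
  by rewrite lt0r_neq0.
have H0 : H != 0.
  by apply: contraNneq Gn0 => h0; rewrite -oppr_eq0 -WH h0 mulr0.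
have GE : G = - (W^`().[lambda i] * H) by rewrite WH opprK.
apply: (mulfI H0); rewrite mulrCA -PQ -expr2 P2 GE; ring.
Qed.

(** For [slope_unique]: if the values at [a] agree, equal Wronskians only leave a
    relation between the derivatives. *)
Lemma wronskian_values a (st su : {poly R} * {poly R}) :
  2%:R * wronskian su st =
  pvalue a st * ((ehalf a)%:P * su.1 - (ehalf (- a))%:P * su.2)
  + ((ehalf (- a))%:P * st.2 - (ehalf a)%:P * st.1) * pvalue a su.
Proof. by have := pehalfN a => uu; rewrite /wronskian /pvalue /value; ring: uu. Qed.

Lemma state_of_values a (st su : {poly R} * {poly R}) :
  pvalue a st = pvalue a su ->
  (ehalf (- a))%:P * st.2 - (ehalf a)%:P * st.1 =
  (ehalf (- a))%:P * su.2 - (ehalf a)%:P * su.1 -> st = su.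
Proof.
move=> e1 e2; have uu := pehalfN a.
have two : (2%:R : {poly R}) != 0 by rewrite -polyC_natr polyC_eq0 pnatr_eq0.
have inv (st0 : {poly R} * {poly R}) (d := (ehalf (- a))%:P * st0.2 - (ehalf a)%:P * st0.1) :
    2%:R * st0.1 = (ehalf (- a))%:P * (pvalue a st0 - d) /\
    2%:R * st0.2 = (ehalf a)%:P * (pvalue a st0 + d).
  by rewrite /d /pvalue /value; split; ring: uu.
have [h1 g1] := inv st; have [h2 g2] := inv su.
rewrite e1 e2 -h2 in h1; rewrite e1 e2 -g2 in g1.
by rewrite [st]surjective_pairing (mulfI two h1) (mulfI two g1) -surjective_pairing.
Qed.

Lemma size_slope x n (st : {poly R} * {poly R}) : dominated x n st ->
  (size ((ehalf (- x))%:P * st.2 - (ehalf x)%:P * st.1)%R <= n.+1)%N.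
Proof.
move=> [s1 s2 _]; rewrite !mul_polyC (leq_trans (size_polyD _ _))//.
by rewrite size_polyN geq_max !(leq_trans (size_scale_leq _ _)).
Qed.

Lemma pvalue_flip a (st : {poly R} * {poly R}) :
  pvalue (- a) (flip st) = pvalue a st.
Proof. by rewrite !pvalueE opprK addrC. Qed.

(** The difference of the two derivatives vanishes at [z = 0] and has at most the
    degree of the common value [P]; the equation, with [A] prime to [P], makes it a
    multiple of [P], hence zero. *)
Lemma slope_unique w1 v1 w2 v2 x (s : seq R) (A B : {poly R}) :
  pairwise <%R s -> all (> x) s ->
  pvalue x (state w1 v1 s) = pvalue x (state w2 v2 s) ->
  coprimep (pvalue x (state w1 v1 s)) A ->
  let slope st := (ehalf (- x))%:P * st.2 - (ehalf x)%:P * st.1 in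
  (slope (state w1 v1 s) - slope (state w2 v2 s)) * A =
    B * pvalue x (state w1 v1 s) ->
  state w1 v1 s = state w2 v2 s.
Proof.
move=> ps xs eP cop slope e; apply: (state_of_values eP); apply: subr0_eq.
rewrite -/(slope (state w1 v1 s)) -/(slope (state w2 v2 s)).
have [n1 d1] := dominated_state w1 v1 ps xs.
have [n2 d2] := dominated_state w2 v2 ps xs.
have n12 : n1 = n2 by have := size_pvalue d1; rewrite eP (size_pvalue d2) => -[].
apply: (@dvdp_small (pvalue x (state w1 v1 s))).
- by rewrite -(Gauss_dvdpl _ cop) e dvdp_mull.
- rewrite (size_pvalue d1) (leq_trans (size_polyD _ _))// size_polyN geq_max.
  by rewrite size_slope// n12 size_slope.
- by rewrite pvalue_state0 lt0r_neq0 // ehalf_gt0.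
- have [h1 g1] := state0 w1 v1 s; have [h2 g2] := state0 w2 v2 s.
  by rewrite /slope !hornerE h1 g1 h2 g2 subrr.
Qed.

Lemma weights_unique w1 v1 w2 v2 l a r n (lambda phi : 'I_n.+1 -> R) :
  pairwise <%R (l ++ a :: r) ->
  (forall i j : 'I_n.+1, (i < j)%N -> lambda i < lambda j) ->
  \sum_i phi i ^+ 2 = 1 -> \sum_i lambda i * phi i ^+ 2 = 0 ->
  (forall i, phi i != 0) ->
  weight_data w1 v1 l a r lambda phi -> weight_data w2 v2 l a r lambda phi ->
  forall x, x \in l ++ a :: r -> w1 x = w2 x /\ v1 x = v2 x.
Proof.
move=> pU llt s1 s2 phi0 D1 D2; set U := l ++ a :: r in pU *.
have [pl pr la ra] : [/\ pairwise <%R l, pairwise <%R r, all (< a) l & all (> a) r].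
  move: pU; rewrite /U pairwise_cat /= => /and3P[/allrelP al pl /andP[ra pr]].
  by split=> //; apply/allP => x xl; apply: al; rewrite ?mem_head.
pose W w v := characteristic w v U.
pose P w v := pvalue a (state w v r); pose Q w v := pvalue a (lstate w v l).
have P0 w v : (P w v).[0] != 0 by rewrite pvalue_state0 lt0r_neq0 ?ehalf_gt0.
have Q0 w v : (Q w v).[0] != 0 by rewrite pvalue_lstate0 lt0r_neq0 ?ehalf_gt0.
have W0 w v : (W w v).[0] = 1 by have [] := state0 w v U.
have WE w v : weight_data w v l a r lambda phi ->
    exists2 c : R, c != 0 & W w v = c *: rootpoly lambda.
  move=> D; have [Wr Wl _ _] := D.
  have [||c e] := split_rootpoly llt Wr Wl.
  - by move=> i; have [] := product_at_eigenvalue pU D i.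
  - by apply/eqP => e; have := W0 w v; rewrite /W e horner0 => /esym/eqP; rewrite oner_eq0.
  exists c => //; apply/eqP => c0.
  by have := W0 w v; rewrite /W e c0 scale0r horner0 => /esym/eqP; rewrite oner_eq0.
have [c c0 W1] := WE _ _ D1.
have W2 : W w2 v2 = c *: rootpoly lambda.
  have [c' _ e] := WE _ _ D2; rewrite e; congr (_ *: _).
  have := W0 w1 v1; have := W0 w2 v2; rewrite e W1 !hornerZ => e2 e1.
  apply: (@mulIf _ (rootpoly lambda).[0]); last by rewrite e1 e2.
  by apply/eqP => r0; move: e1; rewrite r0 mulr0 => /esym/eqP; rewrite oner_eq0.
have lam0 i : lambda i != 0.
  have [_ _ G _] := D1; apply: contraTneq (G i) => ->.
  by rewrite mul0r ltxx.
have prodE w v : weight_data w v l a r lambda phi -> W w v = c *: rootpoly lambda ->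
    P w v * Q w v = - c *: \sum_i (lambda i * phi i ^+ 2) *: rootpoly_but lambda i /\
    (size (P w v * Q w v)%R <= n)%N.
  move=> D e; apply: product_interpolation => //.
  - by rewrite -e.
  - rewrite (leq_trans (size_characteristic w v pl la pr ra))//.
    by rewrite -/U -/(W w v) e size_scale ?size_rootpoly.
  - rewrite hornerM pvalue_state0 pvalue_lstate0 mulrC ehalfN//.
  - by move=> i; rewrite -e; have [] := product_at_eigenvalue pU D i.
have [PQ1 sPQ] := prodE _ _ D1 W1; have [PQ2 _] := prodE _ _ D2 W2.
have PQ : P w1 v1 * Q w1 v1 = P w2 v2 * Q w2 v2 by rewrite PQ1 PQ2.
have mixed w v w' v' : weight_data w v l a r lambda phi ->
    weight_data w' v' l a r lambda phi -> W w' v' = c *: rootpoly lambda ->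
    forall i, exists2 k, 0 < k &
      lambda i * ((P w v).[lambda i] * (Q w' v').[lambda i]) =
      - (rootpoly lambda)^`().[lambda i] * (c * k).
  move=> D D' e i.
  have [m m0 ->] := value_at_eigenvalue i D.
  have [m' m'0 pE] := value_at_eigenvalue i D'.
  have [_] := product_at_eigenvalue pU D' i.
  rewrite hornerM pE -/(Q w' v') -/(W w' v') e derivZ hornerZ.
  move: (phi0 i) (lam0 i); set q := (Q w' v').[_].
  move: (phi i) (lambda i) (horner _ _) => f x d f0 x0 qE.
  exists (x ^+ 2 * f ^+ 2 * m / m').
    by rewrite divr_gt0// mulr_gt0// -exprMn exprn_even_gt0//= mulf_neq0.
  have m'n0 : m' != 0 by rewrite gt_eqF.
  have -> : q = - (c * d) * x * f / m'.
    apply: (mulfI f0); apply: (mulfI m'n0); rewrite mulrA [m' * f]mulrC qE.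
    by field.
  by field.
have PQn0 : P w1 v1 * Q w1 v1 != 0.
  by apply/eqP => e; have := P0 w1 v1; have := Q0 w1 v1;
    rewrite -!rootE => q0 p0; have := congr1 (horner^~ 0) e;
    rewrite /= hornerM horner0 => /eqP; rewrite mulf_eq0 -!rootE (negbTE q0) (negbTE p0).
have sign w v w' v' : weight_data w v l a r lambda phi ->
    weight_data w' v' l a r lambda phi -> W w' v' = c *: rootpoly lambda ->
    forall k, (lambda (gap_lo k) * ((P w v).[lambda (gap_lo k)] * (Q w' v').[lambda (gap_lo k)]))
     * (lambda (gap_hi k) * ((P w v).[lambda (gap_hi k)] * (Q w' v').[lambda (gap_hi k)])) < 0.
  move=> D D' e k; have alt := rootpoly_alternates llt k.
  have [k1 k10 ->] := mixed _ _ _ _ D D' e (gap_lo k).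
  have [k2 k20 ->] := mixed _ _ _ _ D D' e (gap_hi k).
  move: alt; set x := _^`().[_]; set y := _^`().[_] => alt.
  have -> : - x * (c * k1) * (- y * (c * k2)) = x * y * (c ^+ 2 * (k1 * k2)) by ring.
  by rewrite pmulr_llt0// pmulr_rgt0 ?exprn_even_gt0// mulr_gt0.
have Q12 : Q w1 v1 %| Q w2 v2.
  by apply: (dvdp_of_interlacing llt PQ PQn0 sPQ); apply: sign.
have Q21 : Q w2 v2 %| Q w1 v1.
  apply: (dvdp_of_interlacing llt (esym PQ)); rewrite -?PQ//.
  exact: sign.
have eQ : Q w1 v1 = Q w2 v2.
  apply: subr0_eq; apply: (@dvdp_small (Q w1 v1)) => //.
  - by rewrite dvdp_sub.
  - rewrite (leq_trans (size_polyD _ _))// size_polyN geq_max leqnn.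
    by apply: dvdp_leq => //; apply: contraNneq (Q0 w1 v1) => ->; rewrite horner0.
  - by rewrite hornerD hornerN !pvalue_lstate0 subrr.
have Qn0 : Q w1 v1 != 0 by apply: contraNneq (Q0 w1 v1) => ->; rewrite horner0.
have eP : P w1 v1 = P w2 v2 by apply: (mulIf Qn0); rewrite {2}eQ.
have two0 : (2%:R : R) != 0 by rewrite pnatr_eq0.
pose Dp w v := (ehalf (- a))%:P * (state w v r).2 - (ehalf a)%:P * (state w v r).1.
pose Dm w v := (ehalf a)%:P * (lstate w v l).1 - (ehalf (- a))%:P * (lstate w v l).2.
have twoW w v : 2%:R *: W w v =
    P w v * Dm w v + Dp w v * Q w v - 2%:R *: coupling w v a * (P w v * Q w v).
  rewrite /W characteristicE scalerBr -wronskian_values -mulrA scalerAl.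
  by congr (_ - _); rewrite -mul_polyC polyC_natr.
have cop : coprimep (P w1 v1) (Q w1 v1).
  have : coprimep (P w1 v1) (W w1 v1).
    rewrite W1; apply: coprime_rootpoly => // i.
    have [_ _ _ pE] := D1; apply: contraNneq (phi0 i) => e.
    by rewrite pE -/(P w1 v1) e mul0r.
  rewrite -(coprimepZr _ _ two0) twoW.
  set k := 2%:R *: _.
  have -> : P w1 v1 * Dm w1 v1 + Dp w1 v1 * Q w1 v1 - k * (P w1 v1 * Q w1 v1) =
      (Dm w1 v1 - k * Q w1 v1) * P w1 v1 + Dp w1 v1 * Q w1 v1 by ring.
  by rewrite coprimep_addl_mul coprimepMr => /andP[].
have eW : 2%:R *: W w1 v1 = 2%:R *: W w2 v2 by rewrite W1 W2.
rewrite !twoW -eP -eQ in eW; move/eqP: eW; rewrite -subr_eq0 => /eqP eW.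
set k1 := 2%:R *: coupling w1 v1 a in eW; set k2 := 2%:R *: coupling w2 v2 a in eW.
have er : state w1 v1 r = state w2 v2 r.
  apply: (@slope_unique _ _ _ _ a r (Q w1 v1)
    (Dm w2 v2 - Dm w1 v1 + (k1 - k2) * Q w1 v1)) => //=.
  rewrite -/(Dp w1 v1) -/(Dp w2 v2) -/(P w1 v1).
  by apply: subr0_eq; rewrite -[RHS]eW; ring.
have [pl' la'] := mirror_sorted pl la.
have el : state (mirror w1) (mirror v1) (rev (map -%R l)) =
    state (mirror w2) (mirror v2) (rev (map -%R l)).
  apply: (@slope_unique _ _ _ _ (- a) _ (P w1 v1)
    (Dp w2 v2 - Dp w1 v1 + (k1 - k2) * P w1 v1)) => //;
    rewrite -!flip_lstate !pvalue_flip//; first by rewrite coprimep_sym.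
  rewrite opprK -/(Dm w1 v1) -/(Dm w2 v2) -/(Q w1 v1).
  by apply: subr0_eq; rewrite -[RHS]eW; ring.
have ec : coupling w1 v1 a = coupling w2 v2 a.
  have eDp : Dp w1 v1 = Dp w2 v2 by rewrite /Dp er.
  have eDm : Dm w1 v1 = Dm w2 v2.
    by rewrite /Dm /lstate el.
  have : (k2 - k1) * (P w1 v1 * Q w1 v1) == 0.
    by rewrite -eW eDp eDm; apply/eqP; ring.
  rewrite mulf_eq0 (negbTE PQn0) orbF subr_eq0 => /eqP.
  by move/(scalerI two0).
move=> x; rewrite mem_cat inE => /or3P[xl|/eqP ->|xr].
- have xl' : - x \in rev (map -%R l) by rewrite mem_rev map_f.
  by have := state_inj pl' el xl'; rewrite /mirror !opprK.
- exact: coupling_inj.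
- exact: (state_inj pr er).
Qed.
End Uniqueness.

(** * The equation away from the masses *)

Local Open Scope classical_set_scope.
Local Open Scope ring_scope.
Local Open Scope complex_scope.

Section RealOde.
Context {R : realType}.
Implicit Types (g : R -> R) (x y t a b : R).

(** The general solution of [g'' = g / 4]. *)
Definition hyper a b t : R := a * ehalf t + b * ehalf (- t).

Lemma is_derive_hyper a b t : is_derive t 1 (hyper a b) (hyper (a / 2) (- b / 2) t).
Proof.
have e1 : is_derive t (1 : R) (@ehalf R) (ehalf t / 2).
  have -> : @ehalf R = expR \o (fun x => x / 2) by [].
  apply: is_derive_eq; rewrite /ehalf [in RHS]mulrC.
  by rewrite /GRing.scale /=; ring.
have e2 : is_derive t (1 : R) (fun x => ehalf (- x)) (- ehalf (- t) / 2).
  have -> : (fun x => ehalf (- x)) = expR \o (fun x => - x / 2) by [].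
  by apply: is_derive_eq; rewrite /ehalf /GRing.scale /=; ring.
have -> : hyper a b = (a \*: @ehalf R) + (b \*: (fun x => ehalf (- x))) by [].
by apply: is_derive_eq; rewrite /hyper /GRing.scale /=; ring.
Qed.

Lemma continuous_hyper a b : continuous (hyper a b).
Proof.
move=> t; apply: differentiable_continuous; apply/derivable1_diffP.
by have [] := is_derive_hyper a b t.
Qed.

Lemma zero_derive_cst g x y : x <= y ->
  (forall t, x <= t <= y -> is_derive t 1 g 0) -> g x = g y.
Proof.
move=> xy dg; have [| |c _ /esym/eqP] := @MVT_segment R g (fun=> 0) x y xy.
- by move=> t; rewrite in_itv /= => /andP[? ?]; apply: dg; rewrite !ltW.
- apply: derivable_within_continuous => t; by rewrite in_itv /= => /dg [].
by rewrite mul0r eq_sym subr_eq0 eq_sym => /eqP.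
Qed.

(** The first integrals [(g / 2 + s g') e^(- s t / 2)], for [s = 1] and [s = -1], are
    constant on a convex set, and they are the two coefficients.  Taking [D] to be
    any convex set covers bounded gaps, half-lines and the whole line. *)
Lemma ode_hyper g (D : R -> Prop) :
  (forall x y t, D x -> D y -> x <= t <= y -> D t) ->
  (forall t, D t -> [/\ derivable g t 1, derivable (derive1 g) t 1 &
     - derive1 (derive1 g) t + 4^-1 * g t = 0]) ->
  exists a b, forall t, D t -> g t = hyper a b t.
Proof.
move=> convD ode; have [[x0 Dx0]|nD] := pselect (exists x, D x); last first.
  by exists 0, 0 => t Dt; case: nD; exists t.
pose k s (t : R) := (g t / 2 + s * derive1 g t) * ehalf (- s * t).
have dk s t : s ^+ 2 = 1 -> D t -> is_derive t 1 (k s) 0.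
  move=> s1 Dt; have [d1 d2 e] := ode _ Dt.
  have g1 : is_derive t 1 g (derive1 g t) by rewrite derive1E; apply: DeriveDef.
  have g2 : is_derive t 1 (derive1 g) (derive1 (derive1 g) t).
    by rewrite [derive1 (derive1 g) _]derive1E; apply: DeriveDef.
  have e1 : is_derive t (1 : R) (fun t => ehalf (- s * t)) (- s / 2 * ehalf (- s * t)).
    have -> : (fun t => ehalf (- s * t)) = expR \o (fun x => - s * x / 2) by [].
    by apply: is_derive_eq; rewrite /ehalf /GRing.scale /=; ring.
  have -> : k s = ((2^-1 \*: g) + (s \*: derive1 g)) * (fun t => ehalf (- s * t)).
    by apply/funext => u; rewrite /k [g u / 2]mulrC.
  apply: is_derive_eq; rewrite /GRing.scale /=.
  have -> : derive1 (derive1 g) t = g t / 4 by lra.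
  have s1' : s * s = 1 by rewrite -expr2.
  have -> : (2^-1 \*: g + s \*: derive1 g) t = 2^-1 * g t + s * derive1 g t by [].
  by field: s1'.
have cst s t : s ^+ 2 = 1 -> D t -> k s t = k s x0.
  move=> s1 Dt; have [tx|xt] := leP t x0.
    by apply: zero_derive_cst => // u ?; apply: dk => //; apply: (convD t x0).
  by apply/esym/zero_derive_cst => // [|u ?]; [exact: ltW|]; apply: dk => //; apply: (convD x0 t).
exists (k 1 x0), (k (-1) x0) => t Dt; have s1 : (-1 : R) ^+ 2 = 1 by rewrite sqrrN expr1n.
rewrite -(cst 1 t (expr1n _ _) Dt) -(cst (-1) t s1 Dt).
rewrite /hyper /k !(mul1r, mulNr, opprK).
have := ehalfN t; move: (ehalf t) (ehalf (- t)) => u v uv.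
by field: uv.
Qed.

End RealOde.

(** * The matching conditions at the masses *)

Section OneSided.
Context {R : realType}.
Implicit Types (g : R -> R) (x y t a b lo hi : R).

Lemma is_derive_on g a b lo hi : (forall t, lo < t < hi -> g t = hyper a b t) ->
  forall t, lo < t < hi -> is_derive t 1 g (hyper (a / 2) (- b / 2) t).
Proof.
move=> gE t tI; apply: near_eq_is_derive (is_derive_hyper a b t).
have : t \in `]lo, hi[ by rewrite in_itv.
move=> /near_in_itvoo; apply: filterS => u /=; rewrite in_itv /= => /gE.
by move->.
Qed.

Lemma derive1_on g a b lo hi : (forall t, lo < t < hi -> g t = hyper a b t) ->
  forall t, lo < t < hi -> derive1 g t = hyper (a / 2) (- b / 2) t.
Proof. by move=> gE t /(is_derive_on gE) [_ <-]; rewrite derive1E. Qed.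

Lemma cvg_congr (F : set_system R) {FF : ProperFilter F} (g h : R -> R) (l m : R) :
  (\near F, g F = h F) -> g @ F --> l -> h @ F --> m -> l = m.
Proof.
move=> gh gl hm; apply: (@cvg_unique _ _ (h @ F)) => //.
by apply: cvg_trans gl; apply: near_eq_cvg.
Qed.

(** Used for the filters of one-sided neighbourhoods: the formula on the open interval
    passes to the limit. *)
Lemma one_sided_limits (F : set_system R) {FF : ProperFilter F} g a b lo hi x d :
  F --> x -> (\forall t \near F, lo < t < hi) ->
  (forall t, lo < t < hi -> g t = hyper a b t) ->
  g @ nbhs x --> g x -> derive1 g @ F --> d ->
  g x = hyper a b x /\ d = hyper (a / 2) (- b / 2) x.
Proof.
move=> Fx FI gE gx dg; split.
  apply: (@cvg_congr F _ g (hyper a b)).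
  - by near do apply: gE.
  - by apply: cvg_trans gx; apply: cvg_app.
  - by apply: cvg_trans (@continuous_hyper _ a b x); apply: cvg_app.
apply: (@cvg_congr F _ (derive1 g) (hyper (a / 2) (- b / 2))) => //.
- by near do apply: derive1_on gE _ _.
- by apply: cvg_trans (@continuous_hyper _ _ _ x); apply: cvg_app.
Unshelve. all: by end_near. Qed.

End OneSided.

Section ComplexOde.
Context {R : realType}.
Implicit Types (f : R -> R[i]) (x t lo hi : R) (w v : R -> R) (z : R[i]).
Implicit Types (st : R[i] * R[i]) (s : seq R).

Definition cvalue t st : R[i] := value (ehalf t)%:C (ehalf (- t))%:C st.

(** The derivative at [t] of the solution with state [st]. *)
Definition cslope t st : R[i] := cvalue t (st.1 / 2, - st.2 / 2).

Definition ccoupling w v z x : R[i] := z * (w x)%:C + z ^+ 2 * (v x)%:C.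

Definition ccross w v z x : R[i] * R[i] -> R[i] * R[i] :=
  cross (ehalf x)%:C (ehalf (- x))%:C (ccoupling w v z x).

Lemma invn_real n : (n%:R^-1 : R[i]) = (n%:R^-1)%:C.
Proof. by rewrite fmorphV rmorph_nat. Qed.

Lemma ReZr (k : R) z : complex.Re (z * k%:C) = complex.Re z * k.
Proof. by case: z => p q /=; rewrite mulr0 subr0. Qed.

Lemma ImZr (k : R) z : complex.Im (z * k%:C) = complex.Im z * k.
Proof. by case: z => p q /=; rewrite mulr0 add0r. Qed.

Lemma ReD z1 z2 : complex.Re (z1 + z2) = complex.Re z1 + complex.Re z2.
Proof. by case: z1; case: z2. Qed.

Lemma ImD z1 z2 : complex.Im (z1 + z2) = complex.Im z1 + complex.Im z2.
Proof. by case: z1; case: z2. Qed.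

Lemma ReN z : complex.Re (- z) = - complex.Re z. Proof. by case: z. Qed.
Lemma ImN z : complex.Im (- z) = - complex.Im z. Proof. by case: z. Qed.

Lemma complex_ext z1 z2 : complex.Re z1 = complex.Re z2 ->
  complex.Im z1 = complex.Im z2 -> z1 = z2.
Proof. by case: z1; case: z2 => ? ? ? ? /= -> ->. Qed.

Lemma Re_cvalue t st :
  complex.Re (cvalue t st) = hyper (complex.Re st.1) (complex.Re st.2) t.
Proof. by rewrite /cvalue /value ReD !ReZr. Qed.

Lemma Im_cvalue t st :
  complex.Im (cvalue t st) = hyper (complex.Im st.1) (complex.Im st.2) t.
Proof. by rewrite /cvalue /value ImD !ImZr. Qed.

Lemma Re_cslope t st : complex.Re (cslope t st) =
  hyper (complex.Re st.1 / 2) (- complex.Re st.2 / 2) t.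
Proof. by rewrite /cslope Re_cvalue /= !invn_real !ReZr ReN. Qed.

Lemma Im_cslope t st : complex.Im (cslope t st) =
  hyper (complex.Im st.1 / 2) (- complex.Im st.2 / 2) t.
Proof. by rewrite /cslope Im_cvalue /= !invn_real !ImZr ImN. Qed.

Definition free_at f x := [/\ cderivable f x, cderivable (cderive f) x &
  - cderive (cderive f) x + 4^-1 * f x = 0].

Definition jump_at w v z f x := exists dl dr : R[i],
  [/\ ccvg (at_left x) (cderive f) dl, ccvg (at_right x) (cderive f) dr &
      dl = dr + ccoupling w v z x * f x].

Lemma free_cvalue f (D : R -> Prop) :
  (forall x y t, D x -> D y -> x <= t <= y -> D t) ->
  (forall t, D t -> free_at f t) ->
  exists st, forall t, D t -> f t = cvalue t st.
Proof.
move=> cD fr.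
have [t Dt|a [b fab]] := @ode_hyper _ (fun t => complex.Re (f t)) D cD.
  have [[d1 _] [d2 _] e] := fr t Dt; split=> //.
  have := congr1 (@complex.Re R) e.
  by rewrite ReD ReN mulrC invn_real ReZr mulrC.
have [t Dt|c [d fcd]] := @ode_hyper _ (fun t => complex.Im (f t)) D cD.
  have [[_ d1] [_ d2] e] := fr t Dt; split=> //.
  have := congr1 (@complex.Im R) e.
  by rewrite ImD ImN mulrC invn_real ImZr mulrC.
exists (a +i* c, b +i* d) => t Dt.
by apply: complex_ext; rewrite ?Re_cvalue ?Im_cvalue /= ?fab ?fcd.
Qed.

Lemma one_sided_climits (F : set_system R) {FF : ProperFilter F} f st lo hi x d :
  F --> x -> (\forall t \near F, lo < t < hi) ->
  (forall t, lo < t < hi -> f t = cvalue t st) ->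
  ccvg (nbhs x) f (f x) -> ccvg F (cderive f) d ->
  f x = cvalue x st /\ d = cslope x st.
Proof.
move=> Fx FI fE [fx1 fx2] [d1 d2].
have [|r1 r2] := @one_sided_limits _ F FF _ (complex.Re st.1) (complex.Re st.2)
  lo hi x _ Fx FI _ fx1 d1.
  by move=> t tI; rewrite fE// Re_cvalue.
have [|i1 i2] := @one_sided_limits _ F FF _ (complex.Im st.1) (complex.Im st.2)
  lo hi x _ Fx FI _ fx2 d2.
  by move=> t tI; rewrite fE// Im_cvalue.
by split; apply: complex_ext;
  rewrite ?(Re_cvalue, Im_cvalue, Re_cslope, Im_cslope).
Qed.

Lemma cehalfN t : (ehalf t)%:C * (ehalf (- t))%:C = 1 :> R[i].
Proof. by rewrite -rmorphM ehalfN. Qed.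

(** A state is determined by the value and the derivative at [x]. *)
Lemma ccross_of_jump x c st1 st2 :
  cvalue x st1 = cvalue x st2 ->
  cslope x st1 = cslope x st2 + c * cvalue x st2 ->
  st1 = cross (ehalf x)%:C (ehalf (- x))%:C c st2.
Proof.
move=> e1 e2; have uu := cehalfN x.
have n2 : (2%:R : R[i]) != 0 by rewrite pnatr_eq0.
have inv st : st.1 = (ehalf (- x))%:C * (cvalue x st / 2%:R + cslope x st) /\
    st.2 = (ehalf x)%:C * (cvalue x st / 2%:R - cslope x st).
  by rewrite /cslope /cvalue /value /=; split; field: uu.
have [h1 g1] := inv st1; have [h2 g2] := inv st2.
rewrite [st1]surjective_pairing h1 g1 e1 e2.
rewrite /cross -/(cvalue x st2); congr pair.
  by rewrite [in RHS]h2; ring.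
by rewrite [in RHS]g2; ring.
Qed.

Lemma slope_ccross w v z x st :
  cslope x (ccross w v z x st) = cslope x st + ccoupling w v z x * cvalue x st.
Proof.
have uu := cehalfN x; rewrite /cslope /ccross /cross -/(cvalue x st).
by set f := cvalue x st; rewrite /cvalue /value /=; field: uu.
Qed.

Lemma cvalue_ccross w v z x st : cvalue x (ccross w v z x st) = cvalue x st.
Proof. by rewrite /cvalue value_cross// cehalfN. Qed.

(** The state at [t] of the solution with state [st0] near [+oo]. *)
Definition state_after w v z st0 s t : R[i] * R[i] :=
  foldr (ccross w v z) st0 [seq y <- s | t < y].

(** Every solution is determined by its state near [+oo].  The masses are crossed from
    right to left; the up-closed set [D] shrinks to the half-line beyond the first
    position of the list when the induction removes that position. *)
Lemma solution_state w v z f s (D : R -> Prop) :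
  pairwise <%R s -> ccontinuous f ->
  (forall x t, D x -> x <= t -> D t) ->
  (forall t, D t -> t \notin s -> free_at f t) ->
  (forall t, D t -> t \in s -> jump_at w v z f t) ->
  exists st0, forall t, D t -> f t = cvalue t (state_after w v z st0 s t).
Proof.
move=> + cf; elim: s D => [|x s IH] D /=.
  move=> _ uD fr _; have [|t Dt|st fst] := @free_cvalue f D.
  - by move=> x y t Dx _ /andP[+ _]; apply: uD.
  - exact: fr.
  - by exists st => t Dt; rewrite fst.
move=> /andP[xs ps] uD fr ju.
have xns : x \notin s by apply/negP => /(allP xs); rewrite ltxx.
have [| | |st0 fst] := IH (fun t => D t /\ x < t) ps.
- by move=> y t [Dy xy] yt; split; [exact: uD Dy yt|exact: lt_le_trans yt].
- by move=> t [Dt xt] ts; apply: fr => //; rewrite inE negb_or gt_eqF.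
- by move=> t [Dt xt] ts; apply: ju => //; rewrite inE ts orbT.
exists st0 => t Dt; rewrite /state_after /=.
have [xt|tx] := ltP x t.
  by rewrite ltNge (ltW xt) /=; apply: fst.
have Dx : D x by apply: uD Dt tx.
(* On the left of [x] and next to it, all later positions count. *)
have filt_lo u : u <= x -> [seq y <- s | u < y] = s.
  move=> ux; apply/all_filterP; apply: sub_all xs => y.
  exact: le_lt_trans.
set st := foldr (ccross w v z) st0 s.
have [hi xhi fhi] : exists2 hi, x < hi & forall u, x < u < hi -> f u = cvalue u st.
  exists (head (x + 1) s).
    by case: (s) xs => [|y s'] /=; [rewrite ltrDl|case/andP].
  move=> u /andP[xu uh]; rewrite fst; last by split=> //; exact: uD Dx (ltW xu).
  congr (cvalue u (foldr _ _ _)); apply/all_filterP.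
  case: (s) ps uh => [//|y s'] /= /andP[ys _] uy; rewrite uy /=.
  by apply: sub_all ys => k; apply: lt_trans.
have [dl [dr [cl cr dlr]]] : jump_at w v z f x by apply: ju => //; rewrite inE eqxx.
have [fx drE] : f x = cvalue x st /\ dr = cslope x st.
  apply: (@one_sided_climits x^'+ _ f st x hi x dr) => //.
    exact: cvg_within.
  near=> u; apply/andP; split; near: u; [exact: nbhs_right_gt|exact: nbhs_right_lt].
have [->|tnx] := eqVneq t x.
  by rewrite ltxx filt_lo.
have {}tx : t < x by rewrite lt_neqAle tnx.
rewrite tx /= filt_lo ?ltW//.
have [||stl fstl] := @free_cvalue f (fun u => t <= u < x).
- move=> a b u /andP[ta _] /andP[_ bx] /andP[au ub].
  by rewrite (le_trans ta au) (le_lt_trans ub bx).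
- move=> u /andP[tu ux]; apply: fr; first exact: uD Dt tu.
  rewrite inE negb_or lt_eqF//=; apply/negP => /(allP xs).
  by rewrite ltNge (ltW ux).
have [fx' dlE] : f x = cvalue x stl /\ dl = cslope x stl.
  apply: (@one_sided_climits x^'- _ f stl t x x dl) => //.
  - exact: cvg_within.
  - near=> u; apply/andP; split; near: u; [exact: nbhs_left_gt|exact: nbhs_left_lt].
  - by move=> u /andP[tu ux]; apply: fstl; rewrite ltW.
rewrite fstl ?lexx//; congr (cvalue t _); apply: ccross_of_jump.
  by rewrite -fx -fx'.
by rewrite -dlE dlr drE -fx.
Unshelve. all: by end_near. Qed.

End ComplexOde.

(** * Construction of solutions *)

Section Pieces.
Context {R : realType}.
Implicit Types (g : R -> R) (x y t a b lo hi : R).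

Lemma derivable2_on g a b lo hi : (forall t, lo < t < hi -> g t = hyper a b t) ->
  forall t, lo < t < hi ->
  [/\ derivable g t 1, derivable (derive1 g) t 1 &
      derive1 (derive1 g) t = g t / 4].
Proof.
move=> gE t tI; have dE := derive1_on gE.
have [d1 _] := is_derive_on gE tI; have [d2 _] := is_derive_on dE tI.
split; [exact: d1|exact: d2|].
by rewrite (derive1_on dE tI) (gE _ tI) /hyper; field.
Qed.

Lemma cvg_piece (F : set_system R) {FF : Filter F} g a b lo hi x :
  F --> x -> (\forall t \near F, lo < t < hi) ->
  (forall t, lo < t < hi -> g t = hyper a b t) ->
  g @ F --> hyper a b x /\ derive1 g @ F --> hyper (a / 2) (- b / 2) x.
Proof.
move=> Fx FI gE; split.
  apply: (cvg_trans (G := hyper a b @ F)).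
    by apply: near_eq_cvg; near do apply/esym/gE.
  by apply: cvg_trans (@continuous_hyper _ a b x); apply: cvg_app.
apply: (cvg_trans (G := hyper (a / 2) (- b / 2) @ F)).
  by apply: near_eq_cvg; near do apply/esym/(derive1_on gE).
by apply: cvg_trans (@continuous_hyper _ _ _ x); apply: cvg_app.
Unshelve. all: by end_near. Qed.

(** Between the tails a continuous function on a segment is bounded. *)
Lemma bounded_of_tails g lo hi K1 K2 : continuous g ->
  (forall t, t <= lo -> `|g t| <= K1) -> (forall t, hi <= t -> `|g t| <= K2) ->
  exists M, forall t, `|g t| <= M.
Proof.
move=> cg g1 g2; have [lh|hl] := leP lo hi; last first.
  exists (Num.max K1 K2) => t; rewrite le_max.
  by have [/g1 ->|/ltW lt] := leP t lo; rewrite ?orbT// g2 ?orbT// (le_trans (ltW hl)).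
have cn : {within `[lo, hi], continuous (fun t => `|g t|)}.
  apply: continuous_subspaceT => t; apply: continuous_comp; [exact: cg|exact: norm_continuous].
have [c _ gc] := EVT_max lh cn.
exists (Num.max (Num.max K1 K2) `|g c|) => t; rewrite !le_max.
have [/g1 ->//|lt] := leP t lo; have [/g2 ->|th] := leP hi t; first by rewrite !orbT.
by rewrite gc ?orbT// in_itv /= !ltW.
Qed.

Lemma hyper_bounded a b lo M : (forall t, lo <= t -> `|hyper a b t| <= M) -> a = 0.
Proof.
move=> bnd; apply/eqP/negPn/negP => a0.
pose K := `|b| * ehalf (- lo) + M.
have aE t : lo <= t -> `|a| * ehalf t <= K.
  move=> lt; have -> : `|a| * ehalf t = `|hyper a b t - b * ehalf (- t)|.
    by rewrite /hyper addrK normrM (ger0_norm (ltW (ehalf_gt0 t))).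
  rewrite (le_trans (ler_normB _ _))// addrC lerD ?bnd//.
  rewrite normrM (ger0_norm (ltW (ehalf_gt0 _))) ler_wpM2l//.
  by rewrite ler_expR; lra.
have K0 : 0 <= K by apply: le_trans (aE lo (lexx _)); rewrite mulr_ge0// ltW// ehalf_gt0.
have na : 0 < `|a| by rewrite normr_gt0.
(* [expR (t / 2)] exceeds [K / `|a|] here, since it is at least [1 + t / 2]. *)
pose t := Num.max lo (2 * (K / `|a|)).
have /aE : lo <= t by rewrite le_max lexx.
apply/negP; rewrite -ltNge mulrC -ltr_pdivrMr//.
apply: (@lt_le_trans _ _ (1 + t / 2)); last exact: expR_ge1Dx.
have : 2 * (K / `|a|) <= t by rewrite le_max lexx orbT.
lra.
Qed.

Lemma hyperN a b t : hyper a b (- t) = hyper b a t.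
Proof. by rewrite /hyper opprK addrC. Qed.

Lemma hyper_bounded_left a b hi M : (forall t, t <= hi -> `|hyper a b t| <= M) -> b = 0.
Proof.
move=> bnd; apply: (@hyper_bounded b a (- hi) M) => t ht.
by rewrite -hyperN bnd// lerNl.
Qed.

Lemma far_right (s : seq R) : exists hi, forall y, y \in s -> y <= hi.
Proof.
elim: s => [|x r [hi IH]]; first by exists 0.
exists (Num.max hi x) => y; rewrite inE le_max => /predU1P[->|/IH ->//].
by rewrite lexx orbT.
Qed.

Lemma far_left (s : seq R) : exists lo, forall y, y \in s -> lo < y.
Proof.
elim: s => [|x r [lo IH]]; first by exists 0.
exists (Num.min lo (x - 1)) => y; rewrite inE gt_min => /predU1P[->|/IH ->//].
by rewrite gtrBl ltr01 orbT.
Qed.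

Lemma filter_lo s x : exists2 lo, lo < x & forall t, lo < t < x ->
  [seq y <- s | t < y] = [seq y <- s | x <= y].
Proof.
elim: s => [|y s [lo lox IH]]; first by exists (x - 1) => //; rewrite gtrBl.
have [xy|yx] := leP x y.
  exists lo => // t /[dup] /IH /= e /andP[_ tx].
  by rewrite e xy (lt_le_trans tx xy).
exists (Num.max lo y) => [|t]; first by rewrite gt_max lox.
rewrite gt_max => /andP[/andP[lot yt] tx] /=.
by rewrite IH ?lot// ltNge (ltW yt) /= leNgt yx.
Qed.

Lemma filter_hi s x : exists2 hi, x < hi & forall t, x <= t < hi ->
  [seq y <- s | t < y] = [seq y <- s | x < y].
Proof.
elim: s => [|y s [hi xhi IH]]; first by exists (x + 1) => //; rewrite ltrDl.
have [yx|xy] := leP y x.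
  exists hi => // t /[dup] /IH /= e /andP[xt _].
  by rewrite e !ltNge yx (le_trans yx xt).
exists (Num.min hi y) => [|t]; first by rewrite lt_min xhi.
rewrite lt_min => /andP[xt /andP[th ty]] /=.
by rewrite IH ?xt// ty xy.
Qed.

End Pieces.

Section Existence.
Context {R : realType}.
Implicit Types (f : R -> R[i]) (x t lo hi : R) (w v : R -> R) (z : R[i]).
Implicit Types (st : R[i] * R[i]) (s : seq R).

Lemma ccross0 w v z x st : w x = 0 -> v x = 0 -> ccross w v z x st = st.
Proof.
move=> w0 v0; rewrite /ccross /ccoupling w0 v0 /cross !(mulr0, mul0r, addr0, subr0).
by case: st.
Qed.

(** Immediately on the left of [x]; a position without mass is crossed trivially, so
    that one formula serves all [x]. *)
Lemma state_before w v z st0 s x : pairwise <%R s ->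
  (forall y, y \notin s -> w y = 0 /\ v y = 0) ->
  foldr (ccross w v z) st0 [seq y <- s | x <= y] =
  ccross w v z x (state_after w v z st0 s x).
Proof.
move=> ps wv0; have [xs|xs] := boolP (x \in s); last first.
  have [w0 v0] := wv0 _ xs; rewrite ccross0// /state_after; congr foldr.
  by apply: eq_in_filter => y ys; rewrite lt_neqAle; case: eqVneq xs => [->|]; rewrite ?ys.
rewrite /state_after; case/splitPr: s / xs ps {wv0} => l r.
rewrite pairwise_cat /= => /and3P[/allrelP al _ /andP[xr _]].
rewrite !filter_cat /= lexx ltxx.
have nl (P : pred R) : (forall y, y < x -> P y = false) -> [seq y <- l | P y] = [::].
  move=> Pf; rewrite -(filter_pred0 l); apply: eq_in_filter => y yl.
  by rewrite Pf// al// mem_head.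
rewrite (nl (fun y => x <= y)) => [|y yx]; last by rewrite leNgt yx.
rewrite (nl (fun y => x < y)) => [|y yx]; last by rewrite ltNge ltW.
rewrite /=; congr (ccross _ _ _ _ (foldr _ _ _)).
by apply: eq_in_filter => y /(allP xr) xy; rewrite xy ltW.
Qed.

Section Piecewise.
Context (w v : R -> R) (z : R[i]) (st0 : R[i] * R[i]) (s : seq R).
Hypothesis ps : pairwise <%R s.
Hypothesis wv0 : forall y, y \notin s -> w y = 0 /\ v y = 0.

(** The solution with state [st0] near [+oo]. *)
Definition piecewise t : R[i] := cvalue t (state_after w v z st0 s t).

Local Notation st x := (state_after w v z st0 s x).

Lemma piecewise_left x : exists2 lo, lo < x & forall t, lo < t < x ->
  piecewise t = cvalue t (ccross w v z x (st x)).
Proof.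
have [lo lox loE] := filter_lo s x; exists lo => // t tI.
by rewrite /piecewise -state_before// /state_after loE.
Qed.

Lemma piecewise_right x : exists2 hi, x < hi & forall t, x <= t < hi ->
  piecewise t = cvalue t (st x).
Proof.
have [hi xhi hiE] := filter_hi s x; exists hi => // t tI.
by rewrite /piecewise /state_after hiE.
Qed.

Lemma piecewise_limits x :
  [/\ ccvg (nbhs x) piecewise (piecewise x),
      ccvg (at_left x) (cderive piecewise) (cslope x (ccross w v z x (st x))) &
      ccvg (at_right x) (cderive piecewise) (cslope x (st x))].
Proof.
have [lo lox loE] := piecewise_left x; have [hi xhi hiE] := piecewise_right x.
have Fl : \forall t \near x^'-, lo < t < x.
  near=> t; apply/andP; split; near: t; [exact: nbhs_left_gt|exact: nbhs_left_lt].
have Fr : \forall t \near x^'+, x < t < hi.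
  near=> t; apply/andP; split; near: t; [exact: nbhs_right_gt|exact: nbhs_right_lt].
have hiE' t : x < t < hi -> piecewise t = cvalue t (st x).
  by move=> /andP[xt th]; apply: hiE; rewrite ltW.
have xE : piecewise x = cvalue x (ccross w v z x (st x)).
  by rewrite cvalue_ccross.
have WFl : x^'- --> x by exact: cvg_within.
have WFr : x^'+ --> x by exact: cvg_within.
have [lR lR'] := @cvg_piece _ _ _ (fun t => complex.Re (piecewise t)) _ _ lo x x
  WFl Fl (fun t tI => etrans (congr1 (@complex.Re R) (loE t tI)) (Re_cvalue _ _)).
have [lI lI'] := @cvg_piece _ _ _ (fun t => complex.Im (piecewise t)) _ _ lo x x
  WFl Fl (fun t tI => etrans (congr1 (@complex.Im R) (loE t tI)) (Im_cvalue _ _)).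
have [rR rR'] := @cvg_piece _ _ _ (fun t => complex.Re (piecewise t)) _ _ x hi x
  WFr Fr (fun t tI => etrans (congr1 (@complex.Re R) (hiE' t tI)) (Re_cvalue _ _)).
have [rI rI'] := @cvg_piece _ _ _ (fun t => complex.Im (piecewise t)) _ _ x hi x
  WFr Fr (fun t tI => etrans (congr1 (@complex.Im R) (hiE' t tI)) (Im_cvalue _ _)).
split; last first.
- by split; [rewrite Re_cslope|rewrite Im_cslope].
- by split; [rewrite Re_cslope|rewrite Im_cslope].
split; apply/left_right_continuousP; split.
- by rewrite xE Re_cvalue.
- by rewrite /piecewise Re_cvalue.
- by rewrite xE Im_cvalue.
- by rewrite /piecewise Im_cvalue.
Unshelve. all: by end_near. Qed.

Lemma piecewise_jump x : jump_at w v z piecewise x.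
Proof.
have [_ h1 h2] := piecewise_limits x.
exists (cslope x (ccross w v z x (st x))), (cslope x (st x)); split=> //.
by rewrite slope_ccross.
Qed.

Lemma piecewise_free x : w x = 0 -> v x = 0 -> free_at piecewise x.
Proof.
move=> w0 v0; have [lo lox loE] := piecewise_left x.
have [hi xhi hiE] := piecewise_right x; rewrite ccross0// in loE.
have E t : lo < t < hi -> piecewise t = cvalue t (st x).
  move=> /andP[lt th]; have [tx|xt] := ltP t x; first by apply: loE; rewrite lt.
  by apply: hiE; rewrite xt.
have xI : lo < x < hi by rewrite lox.
have [r1 r2 r3] := @derivable2_on _ (fun t => complex.Re (piecewise t)) _ _ lo hi
  (fun t tI => etrans (congr1 (@complex.Re R) (E t tI)) (Re_cvalue _ _)) x xI.
have [i1 i2 i3] := @derivable2_on _ (fun t => complex.Im (piecewise t)) _ _ lo hi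
  (fun t tI => etrans (congr1 (@complex.Im R) (E t tI)) (Im_cvalue _ _)) x xI.
split; [exact: conj r1 i1|exact: conj r2 i2|].
apply: complex_ext.
  by rewrite ReD ReN mulrC invn_real ReZr /= r3 addrC subrr.
by rewrite ImD ImN mulrC invn_real ImZr /= i3 addrC subrr.
Qed.

Lemma left_state t : (forall y, y \in s -> t < y) ->
  st t = foldr (ccross w v z) st0 s.
Proof.
by move=> ts; rewrite /state_after; congr foldr; apply/all_filterP/allP => y /ts.
Qed.

Lemma right_state t : (forall y, y \in s -> y <= t) -> st t = st0.
Proof.
move=> ts; rewrite /state_after -[RHS]/(foldr (ccross w v z) st0 [::]); congr foldr.
rewrite -(filter_pred0 s); apply: eq_in_filter => y /ts yt.
by rewrite ltNge yt.
Qed.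

(** The hypotheses remove the growing exponential in both tails. *)
Lemma piecewise_bounded : st0.1 = 0 -> (foldr (ccross w v z) st0 s).2 = 0 ->
  cbounded piecewise.
Proof.
move=> st1 tot2.
have [hi hi_s] := far_right s; have [lo lo_s] := far_left s.
set H := (foldr (ccross w v z) st0 s).1.
have fl t : t <= lo -> piecewise t = H * (ehalf t)%:C.
  move=> tlo; rewrite /piecewise left_state => [|y /lo_s]; last exact: le_lt_trans.
  by rewrite /cvalue /value tot2 mul0r addr0.
have fr t : hi <= t -> piecewise t = st0.2 * (ehalf (- t))%:C.
  move=> tlo; rewrite /piecewise right_state => [|y /hi_s ?]; last exact: le_trans tlo.
  by rewrite /cvalue /value st1 mul0r add0r.
have [cR cI] : continuous (fun t => complex.Re (piecewise t)) /\
    continuous (fun t => complex.Im (piecewise t)).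
  by split=> t; have [[? ?] _ _] := piecewise_limits t.
have bl (k t : R) : t <= lo -> `|k * ehalf t| <= `|k| * ehalf lo.
  move=> tlo; rewrite normrM (ger0_norm (ltW (ehalf_gt0 _))) ler_wpM2l//.
  by rewrite ler_expR; lra.
have br (k t : R) : hi <= t -> `|k * ehalf (- t)| <= `|k| * ehalf (- hi).
  move=> tlo; rewrite normrM (ger0_norm (ltW (ehalf_gt0 _))) ler_wpM2l//.
  by rewrite ler_expR; lra.
have [|t ht|M1 b1] := bounded_of_tails (lo := lo) (hi := hi) (K1 := `|complex.Re H| * ehalf lo)
    (K2 := `|complex.Re st0.2| * ehalf (- hi)) cR.
- by move=> t tlo; rewrite fl// ReZr bl.
- by rewrite fr// ReZr br.
have [|t ht|M2 b2] := bounded_of_tails (lo := lo) (hi := hi) (K1 := `|complex.Im H| * ehalf lo)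
    (K2 := `|complex.Im st0.2| * ehalf (- hi)) cI.
- by move=> t tlo; rewrite fl// ImZr bl.
- by rewrite fr// ImZr br.
exists (M1 + M2) => t; apply: le_trans (lerD (b1 t) (b2 t)).
case: (piecewise t) => x y /=.
rewrite -[leRHS]ger0_norm ?addr_ge0// -sqrtr_sqr ler_sqrt ?sqr_ge0//.
rewrite sqrrD !real_normK ?num_real// addrAC lerDl.
by rewrite mulrn_wge0// mulr_ge0.
Qed.

End Piecewise.

Lemma cvalue_eq0 t : cvalue t (0, 0) = 0 :> R[i].
Proof. by rewrite /cvalue /value !mul0r addr0. Qed.

Lemma ccross_scale w v z k st x :
  ccross w v z x (k * st.1, k * st.2) =
  (k * (ccross w v z x st).1, k * (ccross w v z x st).2).
Proof. by rewrite /ccross /cross /value /=; congr pair; ring. Qed.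

Lemma foldr_ccross_scale w v z k st s :
  foldr (ccross w v z) (k * st.1, k * st.2) s =
  (k * (foldr (ccross w v z) st s).1, k * (foldr (ccross w v z) st s).2).
Proof. by elim: s => [//|x s IH]; rewrite /= IH ccross_scale. Qed.

Lemma Re_le_normc z : `|complex.Re z| <= Normc.normc z.
Proof.
case: z => x y /=; rewrite -sqrtr_sqr ler_sqrt ?addr_ge0 ?sqr_ge0//.
by rewrite lerDl sqr_ge0.
Qed.

Lemma Im_le_normc z : `|complex.Im z| <= Normc.normc z.
Proof.
case: z => x y /=; rewrite -sqrtr_sqr ler_sqrt ?addr_ge0 ?sqr_ge0//.
by rewrite lerDr sqr_ge0.
Qed.

Lemma cvalue_bounded_right st lo M :
  (forall t, lo <= t -> Normc.normc (cvalue t st) <= M) -> st.1 = 0.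
Proof.
move=> bnd; apply: complex_ext.
  apply: (@hyper_bounded _ _ (complex.Re st.2) lo M) => t lt.
  by rewrite -Re_cvalue (le_trans (Re_le_normc _))// bnd.
apply: (@hyper_bounded _ _ (complex.Im st.2) lo M) => t lt.
by rewrite -Im_cvalue (le_trans (Im_le_normc _))// bnd.
Qed.

Lemma cvalue_bounded_left st hi M :
  (forall t, t <= hi -> Normc.normc (cvalue t st) <= M) -> st.2 = 0.
Proof.
move=> bnd; apply: complex_ext.
  apply: (@hyper_bounded_left _ (complex.Re st.1) _ hi M) => t lt.
  by rewrite -Re_cvalue (le_trans (Re_le_normc _))// bnd.
apply: (@hyper_bounded_left _ (complex.Im st.1) _ hi M) => t lt.
by rewrite -Im_cvalue (le_trans (Im_le_normc _))// bnd.
Qed.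

End Existence.

(** * Spectral data of a pair *)

Section Translation.
Context {R : realType}.
Implicit Types (p q : coeff_pair R) (f : R -> R[i]) (x t a : R) (z : R[i]) (s : seq R).

(** The weights as functions on the line, so that two pairs with different positions
    can be compared on a common list of positions. *)
Definition weight_at p (u : 'I_(natoms p) -> R) x : R :=
  \sum_(i < natoms p) (if atom i == x then u i else 0).

Definition wfun p := weight_at (@wweight _ p).
Definition vfun p := weight_at (@vweight _ p).

Lemma atom_inj p : injective (@atom _ p).
Proof.
move=> i j e; apply/val_inj; have [/atom_lt|/atom_lt|//] := ltngtP i j.
  by rewrite e ltxx.
by rewrite e ltxx.
Qed.

Lemma weight_at_atom p (u : 'I_(natoms p) -> R) i : weight_at u (atom i) = u i.
Proof.
rewrite /weight_at (bigD1 i)//= eqxx big1 ?addr0// => j ji.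
by rewrite (inj_eq (@atom_inj p)) (negbTE ji).
Qed.

Lemma weight_at_out p (u : 'I_(natoms p) -> R) x :
  (forall i : 'I_(natoms p), x != atom i) -> weight_at u x = 0.
Proof. by move=> xp; rewrite /weight_at big1// => i _; rewrite eq_sym (negbTE (xp i)). Qed.

Lemma sum_atoms p (u : 'I_(natoms p) -> R) (g : R -> R) s : uniq s ->
  (forall i : 'I_(natoms p), atom i \in s) ->
  \sum_(i < natoms p) u i * g (atom i) = \sum_(x <- s) weight_at u x * g x.
Proof.
move=> us ps; rewrite /weight_at.
under [RHS]eq_bigr do rewrite big_distrl /=.
rewrite exchange_big /=; apply: eq_bigr => i _.
rewrite (bigD1_seq (atom i))//= eqxx big1 ?addr0// => x xi.
by rewrite eq_sym (negbTE xi) mul0r.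
Qed.

Lemma atomP p x : (exists i : 'I_(natoms p), x = atom i) \/
  (forall i : 'I_(natoms p), x != atom i).
Proof.
have [/existsP[i /eqP ->]|/existsPn h] := boolP [exists i : 'I_(natoms p), x == atom i].
  by left; exists i.
by right.
Qed.

Lemma cderivable_cvg f x : cderivable f x -> ccvg (nbhs x) f (f x).
Proof.
by move=> [d1 d2]; split; apply: differentiable_continuous; apply/derivable1_diffP.
Qed.

(** At a point without mass both one-sided derivatives agree, and the matching
    condition holds with zero weight. *)
Lemma solution_jump p z f : solution p z f ->
  forall x, jump_at (wfun p) (vfun p) z f x.
Proof.
move=> [_ fr ju] x; have [[i ->]|xp] := atomP p x.
  have [dl [dr [cl cr e]]] := ju i; exists dl, dr; split=> //.
  by rewrite e /ccoupling /wfun /vfun !weight_at_atom mulrDl addrA.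
have [_ /cderivable_cvg[c1 c2] _] := fr x xp.
exists (cderive f x), (cderive f x); split.
- by split; apply: cvg_within_filter.
- by split; apply: cvg_within_filter.
- by rewrite /ccoupling /wfun /vfun !weight_at_out// !(mulr0, addr0, mul0r).
Qed.

Lemma solution_of_pieces p z f : ccontinuous f ->
  (forall x, wfun p x = 0 -> vfun p x = 0 -> free_at f x) ->
  (forall x, jump_at (wfun p) (vfun p) z f x) -> solution p z f.
Proof.
move=> cf fr ju; split=> //.
- by move=> x xp; apply: fr; rewrite /wfun /vfun weight_at_out.
- move=> i; have [dl [dr [cl cr e]]] := ju (atom i); exists dl, dr; split=> //.
  by rewrite e /ccoupling /wfun /vfun !weight_at_atom mulrDl addrA.
Qed.

Lemma state_eval (w v : R -> R) z s :
  foldr (ccross w v z) (0, 1) s =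
  ((map_poly (real_complex R) (state w v s).1).[z],
   (map_poly (real_complex R) (state w v s).2).[z]).
Proof.
elim: s => [|x s IH] /=; first by rewrite rmorph0 rmorph1 !hornerE.
rewrite IH /ccross /pcross /cross /value /=.
have cE : (map_poly (real_complex R) (coupling w v x)).[z] = ccoupling w v z x.
  rewrite /coupling !(rmorphD, rmorphM) /= !map_polyC /= !map_polyX !hornerE /=.
  by rewrite /ccoupling; ring.
rewrite -cE -/(state w v s); move: (coupling w v x) (state w v s) => c [h g] /=.
by rewrite !(rmorphD, rmorphN, rmorphM) /= !map_polyC !(hornerD, hornerN, hornerM, hornerC).
Qed.

Section OnePair.
Context (p : coeff_pair R) (s : seq R).
Hypothesis ps : pairwise <%R s.
Hypothesis atoms_s : forall i : 'I_(natoms p), atom i \in s.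
Local Notation w := (wfun p).
Local Notation v := (vfun p).

Lemma weights0 y : y \notin s -> w y = 0 /\ v y = 0.
Proof.
move=> ys; rewrite /wfun /vfun !weight_at_out// => i;
  by apply: contraNneq ys => ->.
Qed.

Lemma solution_states z f : solution p z f ->
  exists st0, forall t, f t = cvalue t (state_after w v z st0 s t).
Proof.
move=> sol; have [cf fr _] := sol.
have [| | |st0 h] := @solution_state _ w v z f s (fun=> True) ps cf.
- by [].
- move=> t _ ts; apply: fr => i; by apply: contraNneq ts => ->.
- by move=> t _ _; apply: solution_jump.
by exists st0 => t; apply: h.
Qed.

Lemma piecewise_solution z st0 : solution p z (piecewise w v z st0 s).
Proof.
apply: solution_of_pieces.
- by move=> x; have [] := @piecewise_limits _ w v z st0 s ps weights0 x.
- by move=> x; apply: (@piecewise_free _ w v z st0 s ps weights0).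
- by move=> x; apply: (@piecewise_jump _ w v z st0 s ps weights0).
Qed.

(** A bounded solution has no growing part near [+oo], so it is a multiple of [phi_+];
    near [-oo] the part [e^(-x/2)] of [phi_+] must vanish too, and its coefficient is
    [characteristic].  Conversely, [phi_+] is then bounded. *)
Lemma eigenvalueP z :
  is_eigenvalue p z <-> root (map_poly (real_complex R) (characteristic w v s)) z.
Proof.
have [hi hi_s] := far_right s; have [lo lo_s] := far_left s.
split=> [[f [sol [M fM] [x fx]]]|rz].
  have [st0 fE] := solution_states sol.
  have st1 : st0.1 = 0.
    apply: (@cvalue_bounded_right _ _ hi M) => t ht; have := fM t.
    by rewrite fE (right_state _) // => y /hi_s yhi; apply: le_trans ht.
  have tot2 : (foldr (ccross w v z) st0 s).2 = 0.
    apply: (@cvalue_bounded_left _ _ lo M) => t tl; have := fM t.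
    by rewrite fE (left_state _) // => y /lo_s; apply: le_lt_trans.
  have st0E : st0 = (st0.2 * 0, st0.2 * 1).
    by rewrite mulr0 mulr1 -st1; case: st0 {st1 tot2 fE}.
  have st2 : st0.2 != 0.
    apply: contraNneq fx => st2; rewrite fE /state_after st0E st2.
    have := @foldr_ccross_scale _ w v z 0 (0, 1) [seq y <- s | x < y].
    by rewrite /= !mul0r => ->; rewrite cvalue_eq0.
  move: tot2; rewrite st0E (@foldr_ccross_scale _ w v z _ (0, 1)) state_eval /= => /eqP.
  by rewrite mulf_eq0 (negbTE st2).
exists (piecewise w v z (0, 1) s); split.
- exact: piecewise_solution.
- apply: piecewise_bounded => //.
    exact: weights0.
  by rewrite state_eval /=; apply/eqP.
- exists hi; rewrite /piecewise right_state// /cvalue /value /= mul0r add0r mul1r.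
  rewrite -[0]/((0 : R)%:C) (inj_eq (@complexI R)).
  by rewrite gt_eqF// ehalf_gt0.
Qed.

Lemma phi_plus_value (lambda : R) f : phi_plus p lambda%:C f ->
  forall t, f t = ((tail_value w v s t).[lambda])%:C.
Proof.
move=> [sol fright]; have [st0 fE] := solution_states sol.
have [hi hi_s] := far_right s.
have [M [_ fM]] := fright.
have cE t : Num.max hi (M + 1) <= t ->
    cvalue t (st0.1, st0.2 - 1) = 0.
  rewrite ge_max => /andP[ht Mt]; have := fM t.
  rewrite fE right_state => [|y /hi_s yhi]; last exact: le_trans ht.
  have -> : cvalue t (st0.1, st0.2 - 1) = cvalue t st0 - (ehalf (- t))%:C.
    by rewrite /cvalue /value /=; ring.
  move=> ->; first by rewrite /ehalf subrr.
  by rewrite (lt_le_trans _ Mt)// ltrDl.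
have st1 : st0.1 = 0.
  apply: (@cvalue_bounded_right _ (st0.1, st0.2 - 1) (Num.max hi (M + 1)) 0) => t ht.
  by rewrite cE// Normc.normc0.
have st2 : st0.2 = 1.
  have := cE _ (lexx _); rewrite st1 /cvalue /value /= mul0r add0r => /eqP.
  rewrite mulf_eq0 subr_eq0 => /orP[/eqP //|].
  by rewrite -[0]/((0 : R)%:C) (inj_eq (@complexI R)) gt_eqF// ehalf_gt0.
move=> t; rewrite fE /state_after [st0]surjective_pairing st1 st2 state_eval.
rewrite !horner_map /= /tail_value pvalueE !hornerE /=.
by rewrite /cvalue /value /= rmorphD !rmorphM /= mulrC [X in _ + X]mulrC.
Qed.

Lemma normc_real (x : R) : Normc.normc x%:C = `|x|.
Proof. by rewrite /= expr0n /= addr0 sqrtr_sqr. Qed.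

Lemma gamma2E (lambda : R) f : phi_plus p lambda%:C f ->
  gamma2 p lambda f = norming w v s lambda.
Proof.
move=> ph; have us : uniq s by apply: (sorted_uniq lt_trans ltxx);
  rewrite (sorted_pairwise lt_trans).
pose sq x := Normc.normc (f x) ^+ 2.
rewrite /gamma2 /int_omega /int_nu (sum_atoms (@wweight _ p) sq us atoms_s).
rewrite (sum_atoms (@vweight _ p) sq us atoms_s).
rewrite /norming horner_sum big_distrr -big_split /=; apply: eq_bigr => x _.
rewrite /sq (phi_plus_value ph) normc_real real_normK ?num_real// hornerM horner_exp.
rewrite /coupling derivD !derivM !derivC derivX !hornerE /=.
by rewrite /wfun /vfun; ring.
Qed.

End OnePair.

(** A value [phia i] different from zero cannot come from the square root of a
    negative number, so [lambda i * gamma^2 > 0] holds. *)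
Lemma spectral_weight_data p l a r N (lambda : 'I_N -> R) (phia : 'I_N -> R[i]) :
  pairwise <%R (l ++ a :: r) ->
  (forall i : 'I_(natoms p), atom i \in l ++ a :: r) ->
  (forall i, phia i != 0) -> interior_spectral_data p a lambda phia ->
  (forall i, phia i = (complex.Re (phia i))%:C) /\
  weight_data (wfun p) (vfun p) l a r lambda (fun i => complex.Re (phia i)).
Proof.
move=> ps ap phi0 [_ eig dat].
pose G i := lambda i * norming (wfun p) (vfun p) (l ++ a :: r) (lambda i).
pose P := pvalue a (state (wfun p) (vfun p) r).
have tailP : tail_value (wfun p) (vfun p) (l ++ a :: r) a = P.
  rewrite /tail_value /P; congr (pvalue _ (state _ _ _)).
  move: ps; rewrite pairwise_cat /= => /and3P[/allrelP al _ /andP[ar _]].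
  rewrite filter_cat /= ltxx.
  have /all_filterP -> := ar.
  rewrite -[RHS]cat0s; congr (_ ++ _); rewrite -(filter_pred0 l).
  apply: eq_in_filter => y yl; rewrite ltNge ltW//.
  by rewrite al// mem_head.
have phiE i : phia i = (P.[lambda i] / Num.sqrt (G i))%:C.
  have [f [ph ->]] := dat i.
  by rewrite (phi_plus_value ps ap ph) tailP (gamma2E ps ap ph) rmorphM fmorphV.
split=> [i|]; first by rewrite phiE.
split=> [z /(eigenvalueP ps ap) /eig //|i|i|i].
- have /(eigenvalueP ps ap) : is_eigenvalue p (lambda i)%:C by apply/eig; exists i.
  by rewrite rootE horner_map -[0]/((0 : R)%:C) (inj_eq (@complexI R)) => /eqP.
- rewrite -/(G i) ltNge; apply/negP => G0; have := phi0 i.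
  by rewrite phiE ler0_sqrtr// invr0 mulr0 eqxx.
- by rewrite phiE.
Qed.

Lemma measure_sum p (u : 'I_(natoms p) -> R) s (A : set R) : uniq s ->
  (forall i : 'I_(natoms p), atom i \in s) ->
  (\sum_(i < natoms p) (u i)%:E * \d_(atom i) A)%E =
  (\sum_(x <- s) weight_at u x * \1_A x)%:E.
Proof.
move=> us ps; rewrite -(sum_atoms _ _ us ps) -sumEFin.
by apply: eq_bigr => i _; rewrite EFinM diracE.
Qed.

End Translation.

Theorem theorem3p4 (R : realType) (a : R) (N : nat)
    (lambda : 'I_N -> R) (phia : 'I_N -> R[i]) (p : coeff_pair R)
    (hp : interior_spectral_data p a lambda phia)
    (halpha : alpha phia = 0) (hbeta : beta lambda phia = 0)
    (hphia : forall i, phia i != 0) :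
  forall q : coeff_pair R, interior_spectral_data q a lambda phia ->
    forall A : set R, measurable A -> omega q A = omega p A /\ nu q A = nu p A.
Proof.
move=> q hq A _.
(* The point [a] is a position too, possibly without mass. *)
pose U := sort <=%R (undup (a :: codom (@atom R p) ++ codom (@atom R q))).
have pU : pairwise <%R U by rewrite -(sorted_pairwise lt_trans) sort_lt_sorted undup_uniq.
have memU x : (x \in U) = [|| x == a, x \in codom (@atom R p) | x \in codom (@atom R q)].
  by rewrite mem_sort mem_undup inE mem_cat.
have pA (i : 'I_(natoms p)) : atom i \in U by rewrite memU codom_f orbT.
have qA (i : 'I_(natoms q)) : atom i \in U by rewrite memU codom_f !orbT.
have uU : uniq U by rewrite sort_uniq undup_uniq.
have aU : a \in U by rewrite memU eqxx.
suff eqw x : x \in U -> wfun q x = wfun p x /\ vfun q x = vfun p x.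
  rewrite /omega /nu !(measure_sum _ _ uU qA) !(measure_sum _ _ uU pA).
  by split; congr (_%:E); apply: eq_big_seq => x /eqw [ew ev];
    congr (_ * _).
clear memU; case/splitPr: U / aU pU pA qA uU => l r pU pA qA _.
have [preal pdata] := spectral_weight_data pU pA hphia hp.
have [_ qdata] := spectral_weight_data pU qA hphia hq.
have nE i : Normc.normc (phia i) ^+ 2 = complex.Re (phia i) ^+ 2.
  by rewrite [in LHS]preal normc_real real_normK// num_real.
have [llt _ _] := hp.
move/eqP: halpha; rewrite /alpha subr_eq0 => /eqP/esym s1.
move/eqP: hbeta; rewrite /beta oppr_eq0 => /eqP s2.
have {}s1 : \sum_i complex.Re (phia i) ^+ 2 = 1.
  by rewrite -[RHS]s1; apply: eq_bigr => i _; rewrite nE.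
have {}s2 : \sum_i lambda i * complex.Re (phia i) ^+ 2 = 0.
  by rewrite -[RHS]s2; apply: eq_bigr => i _; rewrite nE.
case: N lambda phia hphia hp hq s1 s2 preal pdata qdata nE llt
  => [|n] lambda phia hphia hp hq s1 s2 preal pdata qdata nE llt.
  by move/eqP: s1; rewrite big_ord0 eq_sym oner_eq0.
apply: (weights_unique pU llt s1 s2 _ qdata pdata) => i.
by apply: contraNneq (hphia i) => e; rewrite preal e.
Qed.
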